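(* (a) As $\min\{m,n\}\to\infty$, every maximum $C_4$-free $m\times n$ base admits an admissible augmentation with \[ T\ge\left(\frac14-o(1)\right)mn \] selected pairs, uniformly over the dimensions and the base. (b) For each fixed $c_0>0$, the stronger bound $T\ge mn/4-O_{c_0}(m)$ holds uniformly (over dimensions and maximum bases) when $m\ge c_0n^2$. (c) The constant $1/4$ is sharp: when $n\to\infty$ and $m/n^2\to\infty$, there are maximum bases $B$ whose best augmentation has objective $|B|+T^*(B)=(1/4+o(1))mn$, whereas $z_L(m,n)=(1/3+o(1))mn$. (d) More generally, the lower guarantee $T^*(B)\ge(1/4-o(1))mn$ holds for arbitrary $C_4$-free $m\times n$ bases $B$ along any sequence $m\ge n\to\infty$ with \[ z(m,n)-|B|=o\bigl(n\min\{n,\sqrt m\}\bigr). \]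
   Context: Let $m,n\ge2$. An $m\times n$ binary matrix is identified with the set of its occupied cells $(r,c)\in[m]\times[n]$ (entries equal to $1$). It is $C_4$-free if it has no all-one $2\times2$ submatrix (two distinct rows, two distinct columns). Let $z(m,n)$ be the maximum number of occupied cells in a $C_4$-free $m\times n$ binary matrix. A base is a $C_4$-free set of fixed cells $B\subseteq[m]\times[n]$; it is maximum if $|B|=z(m,n)$. A selected pair is an unordered pair of distinct cells outside $B$. It is nondegenerate if its two cells lie in distinct rows and distinct columns; degenerate pairs (repeated row or repeated column) are also allowed. Given a family $E_2$ of selected pairs, let $O$ be the union of $B$ and all cells of pairs in $E_2$. The family $E_2$ is an admissible augmentation of $B$ if: (S) each cell is used by at most one selected pair; (C2) for each nondegenerate selected pair $((r,c),(s,d))$, the opposite cells $(r,d)$ and $(s,c)$ are not both in $O$; (C3) for each selected pair $((r,c),(s,d))$ (degenerate or not) and all $x\in[m]\setminus\{r,s\}$, $y\in[n]\setminus\{c,d\}$, at least one of the cells $(x,y),(x,c),(x,d),(r,y),(s,y)$ lies outside $O$. $T=|E_2|$ is the number of selected pairs; the objective is $|B|+T$. $T^*(B)$ is the maximum of $T$ over admissible augmentations of the given base $B$. $z_L(m,n)=z(m,n)+\max_{B\ \text{maximum}}T^*(B)$. *)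

(* Defs.v *)
From mathcomp Require Import all_boot.

Set Implicit Arguments.
Unset Strict Implicit.
Unset Printing Implicit Defensive.

Section Augmentation.
Variables m n : nat.

(* An m x n binary matrix is identified with the set of its occupied cells. *)
Local Notation cell := ('I_m * 'I_n)%type.
Implicit Types (A B O : {set cell}) (E : {set {set cell}}).

Definition C4_free A : bool :=
  [forall r, forall s, forall c, forall d, (r != s) && (c != d) ==>
    ~~ [&& (r, c) \in A, (r, d) \in A, (s, c) \in A & (s, d) \in A]].

(* The Zarankiewicz number z(m, n). *)
Definition zar : nat := \max_(A : {set cell} | C4_free A) #|A|.

Definition maximum_base B : bool := C4_free B && (#|B| == zar).

(* Unordered pairs of distinct cells are two-element sets of cells. *)
Definition selected_pairs B E : bool :=
  [forall (p | p \in E), (#|p| == 2) && (p \subset ~: B)].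

Definition occupied B E : {set cell} := B :|: cover E.

Definition cond_C2 E O : bool :=
  [forall r, forall c, forall s, forall d,
    [&& [set (r, c); (s, d)] \in E, r != s & c != d] ==>
    ~~ (((r, d) \in O) && ((s, c) \in O))].

Definition cond_C3 E O : bool :=
  [forall r, forall c, forall s, forall d, ([set (r, c); (s, d)] \in E) ==>
    [forall x, forall y, [&& x != r, x != s, y != c & y != d] ==>
      [|| (x, y) \notin O, (x, c) \notin O, (x, d) \notin O,
          (r, y) \notin O | (s, y) \notin O]]].

(* Selected pairs being nonempty, trivIset E says exactly that each cell is
   used by at most one of them. *)
Definition admissible B E : bool :=
  [&& selected_pairs B E, trivIset E,
      cond_C2 E (occupied B E) & cond_C3 E (occupied B E)].

Definition Tstar B : nat := \max_(E : {set {set cell}} | admissible B E) #|E|.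

Definition zL : nat := zar + \max_(B : {set cell} | maximum_base B) Tstar B.

End Augmentation.

Arguments zar : clear implicits.
Arguments zL : clear implicits.

(* Main.v *)
Require Import Defs.
From mathcomp Require Import all_boot all_order all_algebra finfield.
From mathcomp Require Import zify ring lra.
Set Implicit Arguments.
Unset Strict Implicit.
Unset Printing Implicit Defensive.

(** Why the theorem holds.

    Lower bounds.  Pair the rows by an involution pi and the columns by an
    involution sg.  Each block {r, pi r} x {c, sg c} offers its diagonal pair
    (r, c), (pi r, sg c), and taking one pair per block would give about mn/4
    pairs.  A selected diagonal leaves the other two cells of its block empty, so
    in a violation of the third condition at (x, y) the four cells (x, c),
    (x, sg c), (r, y), (pi r, y) can only be base cells; then x contains both
    columns of a pair, y meets both rows of a pair, and (x, y) is a base cell or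
    the cell of another diagonal.  Giving up the blocks that touch the base or
    such a crossing (x, y) leaves one kind of bad block, where the five cells
    are all in the base (diagonals_admissible).  The involutions are chosen to
    make the loss small.
    Rows with disjoint lines are matched first; the lines left over pairwise
    meet, so they all meet one line l, each in a single point, and rows through
    the same point of l are matched (row_matching).  Hence the columns y
    above lie on one line.  The columns are matched by a reflection c |-> k - c
    modulo n; every pair of columns occurs for exactly one k, so averaging over
    k makes the number of bad blocks small as soon as all lines are short or all
    columns are short (augmentation_bound).

    A base with at least one long line x0 and one long column y0 is far from
    maximum: the lines through y0 have few cells altogether, and many of them can
    be replaced by subsets of x0 taken from a finite affine plane, which gains
    a multiple of n * min(n, sqrt m) cells (crossing_gain).  This gives the
    bound mn/4 for maximum and for nearly maximum bases with m >= n, and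
    transposition covers m < n.  When m >= c0 n^2 the same replacement,
    applied to lines of small size anywhere in the matrix, bounds the size of
    every line of a maximum base by a constant (maximum_base_short_lines), and the
    loss becomes O(m).

    Upper bounds.  When m is much larger than n^2, the maximum bases built here
    consist of one two-element line for every pair of columns and of singletons
    (pair_base).
    If the singletons all lie in one column, two selected cells (r, c), (s, d) can
    have almost no common row x with (x, c) and (x, d) occupied, so the sizes of
    columns c and d add up to at most m + O(1); Cauchy-Schwarz then gives
    T <= mn/4 + o(mn) (Tstar_common_column).  If the singletons are spread over
    three columns, three row classes and three column classes of equal size with
    an empty diagonal of blocks carry 3 (m/3)(n/3) = mn/3 pairs (three_block_base).
    No base does better: for each row x, the cells of the occupied set O receive
    charges such that each pair has charge at least 1, and summing over x gives
    T <= 3/2 (|O| - |O|^2 / mn) up to O(m + n), with |O| >= 2T (Tstar_upper). *)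

(** * Lines and columns of a binary matrix *)

(** Pairwise disjoint subsets of [Z], in the form used for double counting. *)
Lemma sum_card_disjoint (I T : finType) (X : {set I}) (F : I -> {set T}) (Z : {set T}) :
  (forall i, i \in X -> F i \subset Z) ->
  (forall i j t, i \in X -> j \in X -> t \in F i -> t \in F j -> i = j) ->
  \sum_(i in X) #|F i| <= #|Z|.
Proof.
move=> subZ inj.
rewrite (eq_bigr (fun i => \sum_(t in Z) (t \in F i))); last first.
  move=> i iX; rewrite -sum1_card big_mkcond /= [RHS]big_mkcond /=.
  apply: eq_bigr => t _; have := subsetP (subZ i iX) t.
  by case: (t \in F i) => [->|_] //; case: ifP.
rewrite exchange_big /= -sum1_card; apply: leq_sum => t _.
have [/exists_inP[i iX ti]|/exists_inPn no] := boolP [exists i in X, t \in F i].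
  rewrite (bigD1 i) //= ti big1 // => j /andP[jX /eqP ji].
  by apply/eqP; rewrite eqb0; apply/negP => tj; apply: ji; apply: (inj j i t).
by rewrite big1 // => i iX; rewrite (negbTE (no i iX)).
Qed.

Lemma sqr_sum_le (I : finType) (f : I -> nat) :
  (\sum_i f i) ^ 2 <= #|I| * \sum_i f i ^ 2.
Proof.
suff : 2 * (\sum_i f i) ^ 2 <= 2 * (#|I| * \sum_i f i ^ 2) by rewrite leq_mul2l.
have -> : 2 * (\sum_i f i) ^ 2 = \sum_i \sum_j 2 * (f i * f j).
  rewrite -mulnn big_distrlr /= big_distrr /=.
  by apply: eq_bigr => i _; rewrite big_distrr.
have -> : 2 * (#|I| * \sum_i f i ^ 2) = \sum_i \sum_j (f i ^ 2 + f j ^ 2).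
  rewrite [RHS](eq_bigr (fun i => #|I| * f i ^ 2 + \sum_j f j ^ 2)); last first.
    by move=> i _; rewrite big_split /= sum_nat_const.
  by rewrite big_split /= sum_nat_const -big_distrr /= mul2n -addnn.
by apply: leq_sum => i _; apply: leq_sum => j _; apply: nat_Cauchy.
Qed.

Lemma card_trivIset_meeting (T : finType) (E : {set {set T}}) (S : {set T}) :
  trivIset E -> #|[set p in E | p :&: S != set0]| <= #|S|.
Proof.
move=> tE; rewrite -sum1_card.
apply: leq_trans (_ : \sum_(p in [set p in E | p :&: S != set0]) #|p :&: S| <= _).
  by apply: leq_sum => p; rewrite inE => /andP[_]; rewrite card_gt0.
apply: sum_card_disjoint => [p _|p q t]; first exact: subsetIr.
rewrite !inE => /andP[pE _] /andP[qE _] /andP[tp _] /andP[tq _].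
apply/eqP; apply: contraT => pq; have /trivIsetP/(_ _ _ pE qE pq) := tE.
by move/pred0P => /(_ t) /=; rewrite tp tq.
Qed.

Lemma double_bin2 d : 2 * 'C(d, 2) = d * d.-1.
Proof. by rewrite -mul_bin_diag bin1. Qed.

Lemma bin2_leq_sqr d : 'C(d, 2) <= d ^ 2.
Proof. by have := double_bin2 d; nia. Qed.

Section Lines.
Variables m n : nat.
Local Notation cell := ('I_m * 'I_n)%type.
Implicit Types (A B : {set cell}) (E : {set {set cell}}).

Definition line A r : {set 'I_n} := [set c | (r, c) \in A].
Definition column A c : {set 'I_m} := [set r | (r, c) \in A].

(** The form in which the hypothesis is used: the lines form a linear space,
    two lines sharing at most one point. *)
Lemma C4_freeP A :
  reflect (forall r s, r != s -> #|line A r :&: line A s| <= 1) (C4_free A).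
Proof.
apply: (iffP forallP) => [free r s rs | meet r].
  apply/card_le1_eqP => c d; rewrite !inE => /andP[rc sc] /andP[rd sd].
  apply/eqP; apply: contraT => cd.
  have /forallP/(_ s)/forallP/(_ c)/forallP/(_ d)/implyP := free r.
  by rewrite rs (eq_sym c) cd rc rd sc sd => /(_ isT).
apply/forallP => s; apply/forallP => c; apply/forallP => d; apply/implyP.
case/andP => rs cd; apply/negP => /and4P[rc rd sc sd].
have /card_le1_eqP/(_ c d) := meet _ _ rs.
by rewrite !inE rc rd sc sd => /(_ isT isT) /eqP; rewrite eq_sym (negbTE cd).
Qed.

Lemma two_rows_meet_once A r s c d : C4_free A -> r != s ->
  (r, c) \in A -> (s, c) \in A -> (r, d) \in A -> (s, d) \in A -> c = d.
Proof.
move=> /C4_freeP/(_ r s) free /free /card_le1_eqP meet rc sc rd sd.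
by apply: meet; rewrite !inE ?rc ?sc ?rd ?sd.
Qed.

Lemma two_columns_meet_once A r s c d : C4_free A -> c != d ->
  (r, c) \in A -> (s, c) \in A -> (r, d) \in A -> (s, d) \in A -> r = s.
Proof.
move=> free cd rc sc rd sd; apply/eqP; apply: contraT => rs; move: cd.
by rewrite (two_rows_meet_once free rs rc sc rd sd) eqxx.
Qed.

Section Sums.
Import Monoid.Theory.
Variables (R : Type) (idx : R) (op : Monoid.com_law idx).

Lemma big_by_lines A (F : cell -> R) :
  \big[op/idx]_(u in A) F u = \big[op/idx]_r \big[op/idx]_(c in line A r) F (r, c).
Proof.
rewrite (eq_bigl (fun u => (u.1, u.2) \in A)); last by case.
rewrite (eq_bigr (fun u => F (u.1, u.2))); last by case.
rewrite -(pair_big_dep predT (fun r c => (r, c) \in A) (fun r c => F (r, c))) /=.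
by apply: eq_bigr => r _; apply: eq_bigl => c; rewrite inE.
Qed.

Lemma big_by_columns A (F : cell -> R) :
  \big[op/idx]_(u in A) F u = \big[op/idx]_c \big[op/idx]_(r in column A c) F (r, c).
Proof.
rewrite big_by_lines; under eq_bigr => r _ do rewrite big_mkcond.
rewrite exchange_big /=; apply: eq_bigr => c _.
by rewrite [RHS]big_mkcond; apply: eq_bigr => r _; rewrite !inE.
Qed.

End Sums.

Lemma card_by_lines A : #|A| = \sum_r #|line A r|.
Proof. by rewrite -sum1_card big_by_lines; apply: eq_bigr => r _; rewrite sum1_card. Qed.

Lemma card_by_columns A : #|A| = \sum_c #|column A c|.
Proof. by rewrite -sum1_card big_by_columns; apply: eq_bigr => c _; rewrite sum1_card. Qed.

Definition of_lines (f : 'I_m -> {set 'I_n}) : {set cell} := [set u | u.2 \in f u.1].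

Lemma line_of_lines f r : line (of_lines f) r = f r.
Proof. by apply/setP => c; rewrite !inE. Qed.

Lemma C4_free_leq_zar A : C4_free A -> #|A| <= zar m n.
Proof. exact: leq_bigmax_cond. Qed.

Lemma maximum_base_exists : exists B : {set cell}, maximum_base B.
Proof.
have free0 : C4_free (set0 : {set cell}).
  apply/C4_freeP => r s _; rewrite (_ : line _ r = set0) ?set0I ?cards0 //.
  by apply/setP => c; rewrite !inE.
have [|B freeB maxB] := @eq_bigmax_cond _ (@C4_free m n) (fun A => #|A|).
  by apply/card_gt0P; exists set0.
by exists B; apply/andP; split; [exact: freeB | apply/eqP/esym/maxB].
Qed.

(** Every pair of columns lies on at most one line. *)
Lemma sum_bin2_lines B : C4_free B -> \sum_r 'C(#|line B r|, 2) <= 'C(n, 2).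
Proof.
move=> /C4_freeP free.
rewrite -[n in 'C(n, 2)]card_ord -card_draws.
rewrite (eq_bigr (fun r => #|[set P : {set 'I_n} | P \subset line B r & #|P| == 2]|)); last first.
  by move=> r _; rewrite cards_draws.
rewrite (eq_bigl (fun r => r \in setT)); last by move=> r; rewrite inE.
apply: sum_card_disjoint => [r _|r s P _ _]; first by apply/subsetP => P; rewrite !inE => /andP[].
rewrite !inE => /andP[Pr /eqP P2] /andP[Ps _]; apply/eqP; apply: contraT => /free.
by rewrite leqNgt -P2 subset_leq_card // subsetI Pr.
Qed.

(** The lines through [y], with [y] removed, are disjoint. *)
Lemma sum_lines_through B y : C4_free B ->
  \sum_(x in column B y) (#|line B x|).-1 <= n.
Proof.
move=> free.
rewrite (eq_bigr (fun x => #|line B x :\ y|)); last first.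
  by move=> x; rewrite !inE => xy; rewrite (cardsD1 y (line B x)) inE xy.
rewrite -[n in _ <= n]card_ord -cardsT; apply: sum_card_disjoint => [//|r s c].
rewrite !inE => ry sy /andP[cy rc] /andP[_ sc].
exact: (two_columns_meet_once free cy).
Qed.

(** A line with more than [K] cells has at most [2 * 'C(d, 2) / K] of them, and
    the pairs are bounded by [sum_bin2_lines]. *)
Lemma card_C4_free B K : C4_free B -> #|B| * K <= K ^ 2 * m + n ^ 2.
Proof.
move=> /sum_bin2_lines sum2; rewrite card_by_lines big_distrl /=.
apply: leq_trans (_ : \sum_(r : 'I_m) (K ^ 2 + 2 * 'C(#|line B r|, 2)) <= _).
  apply: leq_sum => r _; rewrite double_bin2; case: (#|line B r|) => [|d] //=.
  by have [|] := leqP d.+1 K; nia.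
rewrite big_split /= sum_nat_const card_ord mulnC leq_add2l -big_distrr /=.
by apply: leq_trans (leq_mul (leqnn 2) sum2) _; rewrite double_bin2; nia.
Qed.

(** A line of [d] cells satisfies [d <= 1 + 'C(d, 2)]. *)
Lemma zar_leq : zar m n <= m + 'C(n, 2).
Proof.
apply/bigmax_leqP => B free; rewrite card_by_lines.
apply: leq_trans (_ : \sum_(r : 'I_m) (1 + 'C(#|line B r|, 2)) <= _).
  by apply: leq_sum => r _; case: (#|_|) => [|d] //; have := double_bin2 d.+1; case: d => [|[|d]]; nia.
by rewrite big_split /= sum_nat_const card_ord muln1 leq_add2l sum_bin2_lines.
Qed.

Lemma card_long_lines B D : C4_free B ->
  #|[set r | D < #|line B r|]| * D ^ 2 <= n ^ 2.
Proof.
move=> /sum_bin2_lines sum2.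
apply: leq_trans (_ : 2 * 'C(n, 2) <= _); last by rewrite double_bin2; nia.
apply: leq_trans (leq_mul (leqnn 2) sum2); rewrite -sum_nat_const big_distrr /=.
rewrite big_mkcond /=; apply: leq_sum => r _; rewrite inE double_bin2.
by case: ifP => // Dd; nia.
Qed.

End Lines.

Section Admissible.
Variables m n : nat.
Local Notation cell := ('I_m * 'I_n)%type.
Implicit Types (B : {set cell}) (E : {set {set cell}}).

Lemma admissible_set0 B : admissible B set0.
Proof.
have cov0 : cover (set0 : {set {set 'I_m * 'I_n}}) = set0 by rewrite /cover big_set0.
apply/and4P; split.
- by apply/forallP => p; rewrite inE.
- by rewrite /trivIset big_set0 cov0 cards0.
- by apply/'forall_forallP => r c; apply/'forall_forallP => s d; rewrite inE.
- by apply/'forall_forallP => r c; apply/'forall_forallP => s d; rewrite inE.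
Qed.

Lemma admissible_pairE B E p : admissible B E -> p \in E ->
  exists u v : cell, [/\ p = [set u; v], u != v, u \notin B & v \notin B].
Proof.
case/and4P => /forall_inP sel _ _ _ /sel/andP[/cards2P[u [v [uv ->]]] /subsetP sub].
by exists u, v; split=> //; [have := sub u | have := sub v]; rewrite !inE eqxx ?orbT; apply.
Qed.

(** The five cells form, with the pair, two rectangles sharing the cell [(x, y)];
    this is how the third condition is used. *)
Lemma admissible_no_domino B E (u v : cell) x y : admissible B E -> [set u; v] \in E ->
  x != u.1 -> x != v.1 -> y != u.2 -> y != v.2 ->
  (x, y) \in occupied B E -> (x, u.2) \in occupied B E -> (x, v.2) \in occupied B E ->
  (u.1, y) \in occupied B E -> (v.1, y) \in occupied B E -> False.
Proof.
case: u v => [r c] [s d] /= /and4P[_ _ _ C3] pE xr xs yc yd xy xc xd ry sy.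
move: C3 => /forallP/(_ r)/forallP/(_ c)/forallP/(_ s)/forallP/(_ d)/implyP/(_ pE).
move=> /forallP/(_ x)/forallP/(_ y)/implyP; rewrite xr xs yc yd => /(_ isT).
by rewrite xy xc xd ry sy.
Qed.

Lemma Tstar_attained B : exists2 E, admissible B E & #|E| = Tstar B.
Proof.
have [|E admE maxE] := @eq_bigmax_cond _ (@admissible m n B) (fun E => #|E|).
  by apply/card_gt0P; exists set0; apply: admissible_set0.
by exists E; [exact: admE | rewrite -maxE].
Qed.

End Admissible.

(** * Diagonal pairs in the blocks of two involutions *)

(** One representative of each two-element orbit of an involution. *)
Definition ascents k (pi : 'I_k -> 'I_k) : {set 'I_k} := [set r : 'I_k | r < pi r].

Lemma card_ascents k (pi : 'I_k -> 'I_k) : involutive pi ->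
  2 * #|ascents pi| + #|[set r | pi r == r]| = k.
Proof.
move=> piK; have inj := can_inj piK.
have descents : pi @: ascents pi = [set r : 'I_k | pi r < r].
  apply/setP => r; rewrite inE; apply/imsetP/idP => [[s] | lt].
    by rewrite inE => lt ->; rewrite piK.
  by exists (pi r); rewrite ?inE piK.
have -> : 2 * #|ascents pi| = #|ascents pi| + #|[set r : 'I_k | pi r < r]|.
  by rewrite -descents card_imset // mul2n -addnn.
rewrite -[RHS]card_ord -!sum1_card.
rewrite [X in X + _ + _]big_mkcond [X in _ + X + _]big_mkcond [X in _ + _ + X]big_mkcond.
rewrite -!big_split /= big_mkcond; apply: eq_bigr => r _.
by rewrite !inE -val_eqE /=; case: ltngtP.
Qed.

Section Diagonals.
Variables (m n : nat) (B : {set 'I_m * 'I_n}).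
Variables (pi : 'I_m -> 'I_m) (sg : 'I_n -> 'I_n).
Hypotheses (piK : involutive pi) (sgK : involutive sg).
Local Notation cell := ('I_m * 'I_n)%type.
Implicit Types (u v : cell).

Definition joining_rows : {set 'I_m} :=
  [set x | [exists c, [&& sg c != c, (x, c) \in B & (x, sg c) \in B]]].
Definition joining_columns : {set 'I_n} :=
  [set y | [exists r, [&& pi r != r, (r, y) \in B & (pi r, y) \in B]]].
(** A cell [(x, y)] outside the base, with [x] joining two matched columns and
    [y] joining two matched rows, would spoil every block of that column pair and
    that row pair; no diagonal is allowed to use it. *)
Definition excluded : {set cell} := B :|: setX joining_rows joining_columns.

Definition opposite u : cell := (pi u.1, sg u.2).
Definition block u : {set cell} := [set v | (v.1 \in [set u.1; pi u.1]) && (v.2 \in [set u.2; sg u.2])].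
(** The obstruction that lies entirely in the base, and so cannot be removed
    by emptying cells. *)
Definition obstructed u : bool :=
  [exists x, exists y, [&& (x, y) \in B, (x, u.2) \in B, (x, sg u.2) \in B,
                         (u.1, y) \in B & (pi u.1, y) \in B]].
(** Each block of two orbits is indexed by its corner in the ascents. *)
Definition corners : {set cell} := setX (ascents pi) (ascents sg).
Definition good : {set cell} :=
  [set u in corners | (block u :&: excluded == set0) && ~~ obstructed u].
Definition diagonals : {set {set cell}} := [set [set u; opposite u] | u in good].

Lemma opposite_cornerF u : u \in corners -> opposite u \in corners = false.
Proof. by rewrite !inE /= piK => /andP[lt _]; rewrite ltnNge (ltnW lt). Qed.

Lemma block_corner_inj u v w : u \in corners -> v \in corners ->
  w \in block u -> w \in block v -> u = v.
Proof.
case: u v w => [r c] [s d] [x y]; rewrite !inE /= => /andP[rpi csg] /andP[spi dsg].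
move=> /andP[/orP xr /orP yc] /andP[/orP xs /orP yd].
have -> : r = s.
  case: xr xs => /eqP-> [] /eqP => [|h|h|h]; first by [].
  - by move: rpi spi; rewrite h piK => /ltnW; rewrite leqNgt => /negbTE->.
  - by move: rpi spi; rewrite -h piK => lt; rewrite ltnNge (ltnW lt).
  - exact: (can_inj piK).
congr (_, _).
case: yc yd => /eqP-> [] /eqP => [|h|h|h]; first by [].
- by move: csg dsg; rewrite h sgK => /ltnW; rewrite leqNgt => /negbTE->.
- by move: csg dsg; rewrite -h sgK => lt; rewrite ltnNge (ltnW lt).
- exact: (can_inj sgK).
Qed.

Lemma cover_diagonals v : v \in cover diagonals ->
  exists2 u, u \in good & (v = u \/ v = opposite u).
Proof.
case/bigcupP => p /imsetP[u gu ->]; rewrite !inE => /orP[] /eqP ->; exists u; auto.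
Qed.

Lemma cover_diagonals_excluded v : v \in cover diagonals -> v \notin excluded.
Proof.
case/cover_diagonals => u; rewrite inE => /andP[_ /andP[/eqP/setP blk _]] uv.
have := blk v; rewrite !in_set0 in_setI; have -> : v \in block u.
  by case: uv => ->; rewrite !inE /= !eqxx ?orbT.
by move=> /= ->.
Qed.

(** A block carries one diagonal only, and a block with a diagonal contains no
    base cell. *)
Lemma cover_diagonals_sideF v : v \in cover diagonals ->
  (v.1, sg v.2) \in occupied B diagonals = false.
Proof.
move=> cv; have [u gu uv] := cover_diagonals cv.
have uc : u \in corners by move: gu; rewrite inE => /andP[].
have side : (v.1, sg v.2) \in block u.
  by case: uv => ->; rewrite !inE /= ?sgK !eqxx ?orbT.
have notB : (v.1, sg v.2) \in B = false.
  move: gu; rewrite inE => /andP[_ /andP[/eqP/setP /(_ (v.1, sg v.2)) + _]].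
  by rewrite in_setI side !in_setU in_set0 /=; case: (_ \in B).
rewrite in_setU notB /=; apply/negP => /cover_diagonals[w gw wv].
have wc : w \in corners by move: gw; rewrite inE => /andP[].
have wu : w = u.
  apply: (block_corner_inj wc uc) side.
  by case: wv => ->; rewrite !inE /= !eqxx ?orbT.
have := uc; rewrite !inE => /andP[/ltn_eqF rF /ltn_eqF cF].
rewrite wu in wv.
have {}wv : ((v.1, sg v.2) == u) || ((v.1, sg v.2) == opposite u) by apply/orP; case: wv => ->; [left|right].
move: wv; rewrite -!pair_eqE /=.
by case: uv => -> /=; rewrite /pair_eq /= ?sgK ?eqxx ?[sg _ == _]eq_sym ?[pi _ == _]eq_sym -!val_eqE /= ?rF ?cF ?andbF.
Qed.

Lemma cover_diagonals_oppositeF v : v \in cover diagonals ->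
  (pi v.1, v.2) \in occupied B diagonals = false.
Proof.
case/cover_diagonals => u gu uv.
have pu : [set u; opposite u] \in diagonals by apply: imset_f.
have cov : opposite v \in cover diagonals.
  apply/bigcupP; exists [set u; opposite u] => //.
  case: uv => ->; rewrite in_set2 ?eqxx ?orbT //.
  by rewrite /opposite /= piK sgK -surjective_pairing eqxx.
by have := cover_diagonals_sideF cov; rewrite /= sgK.
Qed.

Lemma diagonal_pair r c s d : [set (r, c); (s, d)] \in diagonals ->
  [/\ s = pi r, d = sg c, pi r != r, sg c != c & ~~ obstructed (r, c)].
Proof.
case/imsetP => -[x y]; rewrite inE => /andP[xyc /andP[_ nobs]] /setP eqp.
have := xyc; rewrite !inE /= => /andP[xpi ysg].
have px : pi x != x by rewrite -val_eqE gtn_eqF.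
have sy : sg y != y by rewrite -val_eqE gtn_eqF.
have swap : obstructed (opposite (x, y)) = obstructed (x, y).
  rewrite /obstructed /= piK sgK; apply: eq_existsb => a; apply: eq_existsb => b.
  by do 5!case: (_ \in B) => //=.
have := eqp (r, c); have := eqp (s, d); have := eqp (x, y); have := eqp (opposite (x, y)).
rewrite !in_set2 !eqxx ?orbT /= => /orP e1 /orP e2 /esym/orP e3 /esym/orP e4.
have [e|e] : (r, c) = (x, y) \/ (r, c) = opposite (x, y) by case: e4 => /eqP; auto.
  have f : (s, d) = opposite (x, y).
    case: e1 => /eqP [] h1 h2; last by rewrite -h1 -h2.
    by case: e => h3 h4; move/eqP: px; rewrite h1 h3 => /(_ erefl).
  by case: e => -> ->; case: f => -> ->.
have f : (s, d) = (x, y).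
  case: e2 => /eqP [] h1 h2; last by rewrite -h1 -h2.
  by case: e => h3 h4; move/eqP: px; rewrite -h3 -h1 => /(_ erefl).
by move: swap; case: e => -> ->; case: f => -> -> ->; rewrite piK sgK eq_sym px eq_sym sy.
Qed.

Lemma opposite_neq u : u \in corners -> opposite u != u.
Proof.
case: u => r c; rewrite !inE /= => /andP[lt _]; apply/eqP => -[h _].
by rewrite h ltnn in lt.
Qed.

(** In a violating configuration the cells [(x, c)], [(x, sg c)] are both
    occupied, so by [cover_diagonals_sideF] neither comes from a diagonal, and
    likewise for [(r, y)], [(pi r, y)]. *)
Lemma diagonals_admissible : admissible B diagonals.
Proof.
have inO v : v \in occupied B diagonals = (v \in B) || (v \in cover diagonals) by rewrite inE.
have cov p : p \in diagonals -> p \subset cover diagonals by move=> pE; apply: bigcup_sup.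
have both x c : (x, c) \in occupied B diagonals -> (x, sg c) \in occupied B diagonals ->
    (x, c) \notin cover diagonals /\ (x, sg c) \notin cover diagonals.
  move=> xc xd; split; apply/negP => /cover_diagonals_sideF /=.
    by rewrite xd.
  by rewrite sgK xc.
apply/and4P; split.
- apply/forallP => p; apply/implyP => pE; apply/andP; split.
    case/imsetP: pE => u; rewrite inE => /andP[uc _] ->.
    by rewrite cards2 [u == _]eq_sym opposite_neq.
  apply/subsetP => v vp; rewrite inE; apply/negP => vB.
  have := cover_diagonals_excluded (subsetP (cov p pE) v vp).
  by rewrite inE vB.
- apply/trivIsetP => p q /imsetP[u + ->] /imsetP[v + ->].
  rewrite inE => /andP[uc _]; rewrite inE => /andP[vc _] pq; apply/pred0P => w /=; apply/negP.
  rewrite !inE => /andP[wu wv]; move/eqP: pq; apply; rewrite (_ : u = v) //.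
  by apply: (@block_corner_inj u v w uc vc); [move: wu|move: wv]; case/orP => /eqP->; rewrite !inE /= !eqxx ?orbT.
- apply/forallP => r; apply/forallP => c; apply/forallP => s; apply/forallP => d.
  apply/implyP => /and3P[pE _ _]; have [_ -> _ _ _] := diagonal_pair pE.
  rewrite (@cover_diagonals_sideF (r, c)) //.
  by apply: (subsetP (cov _ pE)); rewrite !inE eqxx.
- apply/forallP => r; apply/forallP => c; apply/forallP => s; apply/forallP => d.
  apply/implyP => pE; have [-> -> pr sc nobs] := diagonal_pair pE.
  apply/forallP => x; apply/forallP => y; apply/implyP => _; apply/negPn.
  rewrite !negb_or !negbK; apply/negP => /and5P[xy xc xd ry sy].
  have [/negbTE xcE /negbTE xdE] := both _ _ xc xd.
  have [/negbTE ryE /negbTE syE] : (r, y) \notin cover diagonals /\ (pi r, y) \notin cover diagonals.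
    split; apply/negP => /cover_diagonals_oppositeF /=; first by rewrite sy.
    by rewrite piK ry.
  move: xc xd ry sy; rewrite !inO xcE xdE ryE syE !orbF => xc xd ry sy.
  (* The four outer cells are now base cells, so (x, y) is obstructing if it is
     a base cell and excluded if it is not. *)
  move: xy; rewrite inO => /orP[xy | /cover_diagonals_excluded/negP[]].
    case/negP: nobs; apply/existsP; exists x; apply/existsP; exists y.
    by rewrite xy xc xd ry sy.
  rewrite !inE; apply/orP; right; apply/andP; split; apply/existsP.
    by exists c; rewrite sc xc.
  by exists r; rewrite pr ry.
Qed.

(** Blocks are disjoint, so an excluded cell spoils at most one of them. *)
Lemma card_diagonals : #|corners| <= #|diagonals| + #|excluded| +
  #|[set u in corners | obstructed u]|.
Proof.
have -> : #|diagonals| = #|good|.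
  apply: card_in_imset => u v; rewrite inE => /andP[uc _]; rewrite inE => /andP[vc _] /setP /(_ u).
  rewrite !in_set2 eqxx /= => /esym/orP[/eqP // | /eqP uv].
  by move: (opposite_cornerF vc); rewrite -uv uc.
apply: leq_trans (_ : #|good| + #|[set u in corners | block u :&: excluded != set0]| +
    #|[set u in corners | obstructed u]| <= _).
  apply: leq_trans (leq_trans (leq_card_setU _ _).1 (leq_add (leq_card_setU _ _).1 (leqnn _))).
  apply/subset_leq_card/subsetP => u; rewrite !in_set => ->.
  by case: (_ == _); case: obstructed.
rewrite leq_add2r leq_add2l -sum1_card.
apply: leq_trans (_ : \sum_(u in [set u in corners | block u :&: excluded != set0])
  #|block u :&: excluded| <= _).
  by apply: leq_sum => u; rewrite inE => /andP[_]; rewrite card_gt0.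
apply: sum_card_disjoint => [u _|u v w]; first exact: subsetIr.
rewrite inE => /andP[uc _]; rewrite inE => /andP[vc _].
by rewrite in_setI => /andP[wu _]; rewrite in_setI => /andP[wv _]; apply: block_corner_inj wu wv.
Qed.

End Diagonals.

(** * Matching the rows *)

(** A maximal matching of the graph [e] inside [G], given as an involution whose
    fixed points include the unmatched vertices. *)
Lemma maximal_matching (T : finType) (e : rel T) (G : {set T}) : symmetric e ->
  exists pi : T -> T, [/\ involutive pi,
    forall r, pi r != r -> [/\ r \in G, pi r \in G & e r (pi r)] &
    forall r s, r \in G -> s \in G -> pi r = r -> pi s = s -> r != s -> ~~ e r s].
Proof.
move=> esym; have [k] := ubnP #|G|; elim: k => // k IH in G *; rewrite ltnS => leGk.
have [/exists_inP[a aG /exists_inP[b bG /andP[ab eab]]] | no] :=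
    boolP [exists a in G, exists b in G, (a != b) && e a b]; last first.
  exists id; split=> // [r|r s rG sG _ _ rs]; first by rewrite eqxx.
  apply: contra no => ers; apply/exists_inP; exists r => //.
  by apply/exists_inP; exists s => //; rewrite rs.
have [|pi [piK mate rest]] := IH (G :\ a :\ b).
  move: leGk; rewrite (cardsD1 a) aG (cardsD1 b (G :\ a)) !inE bG eq_sym ab /=; lia.
have fixed x : x \notin G :\ a :\ b -> pi x = x.
  by move=> xG; apply/eqP; apply: contraT => /mate[]; rewrite (negbTE xG).
have [pia pib] : pi a = a /\ pi b = b by split; apply: fixed; rewrite !inE eqxx ?andbF.
pose tau r := if r == a then b else if r == b then a else pi r.
have tauE r : r != a -> r != b -> tau r = pi r.
  by rewrite /tau => /negbTE-> /negbTE->.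
have taua : tau a = b by rewrite /tau eqxx.
have taub : tau b = a by rewrite /tau eqxx eq_sym (negbTE ab).
exists tau; split=> [r|r|r s rG sG].
- have [->|ra] := eqVneq r a; first by rewrite taua taub.
  have [->|rb] := eqVneq r b; first by rewrite taub taua.
  rewrite [tau r]tauE // tauE ?piK //.
    by apply: contra_neq ra => h; rewrite -[r]piK h pia.
  by apply: contra_neq rb => h; rewrite -[r]piK h pib.
- have [->|ra] := eqVneq r a; first by rewrite taua aG bG eab.
  have [->|rb] := eqVneq r b; first by rewrite taub aG bG esym eab.
  by rewrite tauE // => /mate[]; rewrite !inE => /and3P[_ _ ->] /and3P[_ _ ->].
have [->|ra] := eqVneq r a; first by rewrite taua => h; rewrite h eqxx in ab.
have [->|rb] := eqVneq r b; first by rewrite taub => h; rewrite h eqxx in ab.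
have [->|sa] := eqVneq s a; first by rewrite taua => _ h; rewrite h eqxx in ab.
have [->|sb] := eqVneq s b; first by rewrite taub => _ h; rewrite h eqxx in ab.
by rewrite !tauE //; apply: rest; rewrite !inE ?ra ?rb ?sa ?sb.
Qed.

Section RowMatching.
Variables m n : nat.
Implicit Types B : {set 'I_m * 'I_n}.

(** Disjoint short lines are matched first. The short lines that remain meet
    pairwise, hence all meet any chosen one [l] of them, and are matched
    according to the point where they meet [l]. Thus [Y], which catches all common
    points of matched lines, is a single short line. *)
Lemma row_matching B D : C4_free B ->
  exists (pi : 'I_m -> 'I_m) (Y : {set 'I_n}),
  [/\ involutive pi,
      forall r, pi r != r -> line B r :&: line B (pi r) \subset Y,
      Y = set0 \/ exists2 l, #|line B l| <= D & Y = line B l &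
      #|[set r | pi r == r]| <= D.+1 + #|[set r | D < #|line B r|]| ].
Proof.
move=> free; pose short := [set r | #|line B r| <= D].
pose disj : rel 'I_m := fun r s => [disjoint line B r & line B s].
have [|pi [piK mate rest]] := @maximal_matching _ disj short.
  by move=> r s; rewrite /disj disjoint_sym.
(* I collects the short lines left over; any two of them meet. *)
pose I := [set r in short | pi r == r].
have meets r s : r \in I -> s \in I -> r != s -> exists y, y \in line B r /\ y \in line B s.
  rewrite !inE => /andP[rS /eqP rf] /andP[sS /eqP sf] rs.
  have /pred0Pn[y /andP[yr ys]] : ~~ disj r s by apply: rest; rewrite ?inE.
  by exists y.
have fixE : [set r | pi r == r] \subset I :|: [set r | D < #|line B r|].
  by apply/subsetP => r; rewrite !inE => ->; rewrite andbT; case: leqP.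
have [I0 | [l lI]] := set_0Vmem I.
  exists pi, set0; split=> //; first by move=> r /mate[_ _]; rewrite subset0 setI_eq0.
    by left.
  by apply: leq_trans (subset_leq_card fixE) _; rewrite I0 set0U leq_addl.
(* Lines of I through the same point of l meet nowhere else. *)
pose onl : rel 'I_m := fun r s => line B r :&: line B s :&: line B l != set0.
have [|rho [rhoK mate' rest']] := @maximal_matching _ onl (I :\ l).
  by move=> r s; rewrite /onl [line B r :&: _]setIC.
have lD : #|line B l| <= D by move: lI; rewrite !inE => /andP[].
have rhoI r : r \in I -> rho r \in I.
  by have [->|/mate'[]] := eqVneq (rho r) r; rewrite // !inE => _ /andP[_].
have piI r : r \in I -> pi r = r by rewrite inE => /andP[_ /eqP].
pose tau r := if r \in I then rho r else pi r.
exists tau, (line B l); split.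
- move=> r; rewrite /tau; case: (boolP (r \in I)) => rI; first by rewrite rhoI // rhoK.
  rewrite ifN ?piK //; apply: contra rI => prI; have := piI _ prI; rewrite piK => e.
  by rewrite e.
- move=> r; rewrite /tau; case: ifP => rI; last first.
    by move=> /mate[_ _]; rewrite /disj -setI_eq0 => /eqP->; rewrite sub0set.
  move=> rr; have [_ _ /set0Pn[y]] := mate' _ rr; rewrite !inE => /andP[/andP[ry sy] ly].
  apply/subsetP => z; rewrite !inE => /andP[rz sz].
  by rewrite (two_rows_meet_once free _ rz sz ry sy) // eq_sym.
- by right; exists l.
have -> : [set r | tau r == r] = [set r in I | rho r == r] :|: ([set r | pi r == r] :\: I).
  apply/setP => r; rewrite in_setU in_setD 2!inE [in RHS]inE /tau.
  by case: (r \in I); rewrite ?orbF.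
apply: leq_trans (leq_card_setU _ _).1 _; apply: leq_add; last first.
  apply: subset_leq_card; rewrite subDset; exact: fixE.
rewrite (cardsD1 l) -add1n; apply: leq_add; first by case: (_ \in _).
(* At most one line is left over for each point of l. *)
apply: leq_trans lD; pose J := [set r in I | rho r == r] :\ l.
have JI r : r \in J -> [/\ r != l, r \in I & rho r = r].
  by rewrite in_setD1 inE => /and3P[-> -> /eqP].
apply: leq_trans (_ : \sum_(r in J) #|line B r :&: line B l| <= _).
  rewrite -sum1_card; apply: leq_sum => r /JI[rl rI _]; rewrite card_gt0.
  by have [y [yr yl]] := meets _ _ rI lI rl; apply/set0Pn; exists y; rewrite inE yr.
apply: sum_card_disjoint => [r _|r s y rJ sJ]; first exact: subsetIr.
rewrite !in_setI => /andP[ry yl] /andP[sy _]; apply/eqP; apply: contraT => rs.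
have [rl rI rr] := JI _ rJ; have [sl sI ss] := JI _ sJ.
have := rest' r s; rewrite !in_setD1 rl rI sl sI => /(_ isT isT rr ss rs)/negP[].
by apply/set0Pn; exists y; rewrite !in_setI ry sy.
Qed.

End RowMatching.

(** * Matching the columns *)

Lemma leq_card_bigcup (I T : finType) (A : {set I}) (F : I -> {set T}) :
  #|\bigcup_(i in A) F i| <= \sum_(i in A) #|F i|.
Proof.
elim/big_rec2: _ => [|i x y _ le]; first by rewrite cards0.
by apply: leq_trans (leq_card_setU _ _).1 _; rewrite leq_add2l.
Qed.

Section Reflections.
Variable n : nat.
Import GRing.Theory.

(** The reflections partition the pairs of columns into matchings. *)
Definition reflection (k : 'I_n.+1) (c : 'I_n.+1) : 'I_n.+1 := (k - c)%R.

Lemma reflectionK k : involutive (reflection k).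
Proof. by move=> c; rewrite /reflection opprB addrC subrK. Qed.

Lemma card_fixed_reflection k : #|[set c | reflection k c == c]| <= 2.
Proof.
(* A fixed c has c + c equal to k or to k + n.+1, and this choice determines c. *)
rewrite -card_bool -(@card_in_imset _ _ (fun c : 'I_n.+1 => (n < c + c)%N)).
  exact: max_card.
move=> c d; rewrite !inE /reflection !subr_eq => /eqP kc /eqP kd.
have := congr1 val kc; rewrite kd /= => e h; apply: val_inj => /=; move: e h.
have := ltn_ord c; have := ltn_ord d; move: (val c) (val d) => a b bn an.
have mod_double x : x < n.+1 -> (x + x) %% n.+1 = x + x - (n < x + x)%N * n.+1.
  move=> xn; case: ltnP => h; last by rewrite modn_small //; lia.
  have -> : x + x = (x + x - n.+1) + n.+1 by lia.
  by rewrite modnDr modn_small; lia.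
rewrite !mod_double //; lia.
Qed.

Lemma exists_small_term (F : 'I_n.+1 -> nat) : exists k, n.+1 * F k <= \sum_k F k.
Proof.
case: (@arg_minnP _ ord0 predT F isT) => k _ kmin.
exists k; rewrite -[X in X * _]card_ord -sum_nat_const.
by apply: leq_sum => j _; apply: kmin.
Qed.

(** An ordered pair of distinct elements is reflected by exactly one [k],
    namely its sum. *)
Lemma sum_reflected_pairs (X : {set 'I_n.+1}) :
  \sum_k #|[set c | [&& reflection k c != c, c \in X & reflection k c \in X]]|
  <= #|X| * #|X|.-1.
Proof.
under eq_bigr => k _ do rewrite -sum1_card big_mkcond.
rewrite exchange_big /= -sum_nat_const [X in _ <= X]big_mkcond /=.
apply: leq_sum => c _; case: ifP => cX; last first.
  by rewrite big1 // => k _; rewrite inE cX andbF.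
rewrite (reindex_inj (@addIr _ c)) /=.
rewrite (cardsD1 c X) cX /= -sum1_card [X in _ <= X]big_mkcond /=.
apply: leq_sum => k _; rewrite !inE /reflection addrK.
by case: (_ != _); case: (_ \in X); rewrite ?andbF.
Qed.

End Reflections.

(** Obstructed blocks, summed over all reflections: an obstruction consists of a
    common point [y] of two matched lines, of a third line [x] through [y], and
    of two columns on [x] that the reflection exchanges. *)
Lemma sum_obstructed m n (B : {set 'I_m * 'I_n.+1}) (pi : 'I_m -> 'I_m) :
  \sum_k #|[set u in corners pi (reflection k) | obstructed B pi (reflection k) u]|
  <= \sum_(r | pi r != r) \sum_(y in line B r :&: line B (pi r))
       \sum_(x in column B y) #|line B x| * #|line B x|.-1.
Proof.
pose W k x := [set c | [&& reflection k c != c, c \in line B x & reflection k c \in line B x]].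
apply: leq_trans (_ : \sum_k \sum_(r | pi r != r) \sum_(y in line B r :&: line B (pi r))
       \sum_(x in column B y) #|W k x| <= _); last first.
  rewrite exchange_big /=; apply: leq_sum => r _.
  rewrite exchange_big /=; apply: leq_sum => y _.
  rewrite exchange_big /=; apply: leq_sum => x _.
  exact: sum_reflected_pairs.
apply: leq_sum => k _.
rewrite card_by_lines [X in _ <= X]big_mkcond /=; apply: leq_sum => r _.
case: ifP => [_|/negbFE/eqP rr]; last first.
  rewrite leqn0 cards_eq0; apply/eqP/setP => c; rewrite !inE rr ltnn //.
apply: leq_trans (_ : #|\bigcup_(y in line B r :&: line B (pi r)) \bigcup_(x in column B y) W k x| <= _).
  apply/subset_leq_card/subsetP => c; rewrite 2!inE => /andP[].
  rewrite in_setX /= => /andP[_]; rewrite inE => csg /existsP[x /existsP[y]] /=.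
  case/and5P => xy xc xd ry sy; apply/bigcupP; exists y; first by rewrite !inE ry.
  apply/bigcupP; exists x; rewrite ?inE //.
  by rewrite xc xd !andbT -val_eqE gtn_eqF.
apply: leq_trans (leq_card_bigcup _ _) _; apply: leq_sum => y _.
exact: leq_card_bigcup.
Qed.

(** * The number of selected pairs *)

Section Bound.
Variables m n : nat.
Implicit Types B : {set 'I_m * 'I_n}.

Lemma sum_sqr_lines B : C4_free B -> \sum_r #|line B r| * #|line B r|.-1 <= n ^ 2.
Proof.
move=> /sum_bin2_lines; under [X in _ -> X <= _]eq_bigr => r _ do rewrite -double_bin2.
by rewrite -big_distrr /= => le; apply: leq_trans (leq_mul (leqnn 2) le) _; rewrite double_bin2; nia.
Qed.

(** A pair of columns is joined by at most one row. *)
Lemma card_joining_rows B (sg : 'I_n -> 'I_n) : C4_free B -> #|joining_rows B sg| <= n.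
Proof.
move=> free; rewrite -sum1_card -[n in _ <= n]card_ord -cardsT.
pose W x := [set c | [&& sg c != c, (x, c) \in B & (x, sg c) \in B]].
apply: leq_trans (_ : \sum_(x in joining_rows B sg) #|W x| <= _).
  apply: leq_sum => x; rewrite inE card_gt0 => /existsP[c cW].
  by apply/set0Pn; exists c; rewrite inE.
apply: sum_card_disjoint => [//|x y c _ _]; rewrite !inE => /and3P[cc xc xd] /and3P[_ yc yd].
by apply: (two_columns_meet_once free cc).
Qed.

(** The sum bounding the obstructed blocks. If lines are short, the lines through
    [y] have few pairs of points altogether. If columns are short, few matched
    rows have their common point on a given line [x], since [Y] is a line and
    meets [x] at most once. *)
Lemma obstruction_weight B D K (pi : 'I_m -> 'I_m) (Y : {set 'I_n}) :
  C4_free B -> D <= n ->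
  (forall r, #|line B r| <= D) \/ (forall c, #|column B c| <= K) ->
  (forall r, pi r != r -> line B r :&: line B (pi r) \subset Y) ->
  Y = set0 \/ (exists2 l, #|line B l| <= D & Y = line B l) ->
  \sum_(r | pi r != r) \sum_(y in line B r :&: line B (pi r))
       \sum_(x in column B y) #|line B x| * #|line B x|.-1 <= n * (m * D + n * K).
Proof.
move=> free Dn small subY Yl; have meet := elimT (C4_freeP B) free.
have once r : pi r != r -> #|line B r :&: line B (pi r)| <= 1.
  by move=> rr; apply: meet; rewrite eq_sym.
case: small => [shortr | shortc].
  apply: leq_trans (_ : \sum_(r : 'I_m) D * n <= _); last first.
    by rewrite sum_nat_const card_ord; nia.
  rewrite big_mkcond /=; apply: leq_sum => r _; case: ifP => // rr.
  apply: leq_trans (_ : \sum_(y in line B r :&: line B (pi r)) D * n <= _).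
    apply: leq_sum => y _; apply: leq_trans (_ : \sum_(x in column B y) D * #|line B x|.-1 <= _).
      by apply: leq_sum => x _; rewrite leq_mul2r shortr orbT.
    by rewrite -big_distrr leq_mul2l sum_lines_through ?orbT.
  by rewrite sum_nat_const -[X in _ <= X]mul1n leq_mul2r once ?orbT.
case: Yl => [Y0 | [l lD Yl]].
  rewrite big1 // => r /subY; rewrite Y0 subset0 => /eqP->.
  by rewrite big_set0.
apply: leq_trans (_ : \sum_x #|line B x| * #|line B x|.-1 *
    \sum_(r | pi r != r) #|line B r :&: line B (pi r) :&: line B x| <= _).
  rewrite [X in _ <= X](eq_bigr (fun x => \sum_(r | pi r != r)
    \sum_(y in line B r :&: line B (pi r) :&: line B x) #|line B x| * #|line B x|.-1)); last first.
    move=> x _; rewrite big_distrr /=; apply: eq_bigr => r _.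
    by rewrite sum_nat_const mulnC.
  rewrite [X in _ <= X]exchange_big /=; apply: leq_sum => r _.
  rewrite (eq_bigr (fun y => \sum_x (if (x, y) \in B then #|line B x| * #|line B x|.-1 else 0))); last first.
    by move=> y _; rewrite big_mkcond; apply: eq_bigr => x _; rewrite inE.
  rewrite exchange_big /=; apply: leq_sum => x _.
  by rewrite -big_mkcondr /=; apply/eq_leq/eq_bigl => y; rewrite !inE.
(* The line l itself contributes at most D * D * m. Any other line x meets l
   in at most one y, and at most K rows pass through that y. *)
rewrite (bigD1 l) //=; apply: leq_trans (_ : D * D * m + K * n ^ 2 <= _); last first.
  rewrite mulnDr; apply: leq_add; last by apply: eq_leq; lia.
  by rewrite -mulnA [m * D]mulnC leq_mul.
apply: leq_add.
  apply: leq_mul; first by apply: leq_mul => //; apply: leq_trans (leq_pred _) _.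
  rewrite -[m in _ <= m]card_ord -sum1_card big_mkcond /=; apply: leq_sum => r _.
  case: ifP => // rr; apply: leq_trans (once r rr); exact/subset_leq_card/subsetIl.
apply: leq_trans (_ : \sum_x #|line B x| * #|line B x|.-1 * K <= _); last first.
  by rewrite -big_distrl /= mulnC leq_mul2l sum_sqr_lines ?orbT.
rewrite big_mkcond /=; apply: leq_sum => x _; case: ifP => // xl.
rewrite leq_mul2l; apply/orP; right.
apply: leq_trans (_ : \sum_r \sum_(y in line B l :&: line B x) ((r, y) \in B) <= _).
  rewrite big_mkcond /=; apply: leq_sum => r _; case: ifP => // /subY sY.
  rewrite -sum1_card [X in _ <= X]big_mkcond [X in X <= _]big_mkcond; apply: leq_sum => y _.
  have := subsetP sY y; rewrite Yl !inE; case: (_ \in B) => //=; case: (_ \in B) => //= -> //.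
rewrite exchange_big /=; apply: leq_trans (_ : \sum_(y in line B l :&: line B x) K <= _).
  apply: leq_sum => y _; apply: leq_trans (shortc y); rewrite -sum1_card big_mkcond /=.
  by apply/eq_leq; rewrite [RHS]big_mkcond; apply: eq_bigr => r _; rewrite inE; case: (_ \in B).
by rewrite sum_nat_const -[X in _ <= X]mul1n leq_mul2r meet ?orbT // eq_sym xl.
Qed.
End Bound.

(** With [D] and [K] small compared with [n] and [m], the right-hand side is
    [4 * Tstar B] up to lower order: [#|B|] and [n * D] count blocks meeting
    excluded cells, and the remaining terms count obstructed blocks. *)
Lemma augmentation_bound m n (B : {set 'I_m * 'I_n}) D K : C4_free B -> D <= n ->
  (forall r, #|line B r| <= D) \/ (forall c, #|column B c| <= K) ->
  (m - (D.+1 + #|[set r | D < #|line B r|]|)) * (n - 2)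
    <= 4 * (Tstar B + #|B| + 2 * (m * D + n * (D + K))).
Proof.
case: n B => [|n] B free Dn small; first by rewrite muln0.
have [pi [Y [piK subY Yl fixpi]]] := row_matching D free.
have weight := obstruction_weight free Dn small subY Yl.
have [k kmin] := exists_small_term (fun k =>
  #|[set u in corners pi (reflection k) | obstructed B pi (reflection k) u]|).
have {kmin weight} obs : #|[set u in corners pi (reflection k) | obstructed B pi (reflection k) u]|
    <= m * D + n.+1 * K.
  by rewrite -(leq_pmul2l (ltn0Sn n)); apply: leq_trans kmin (leq_trans (sum_obstructed B pi) weight).
have sgK := reflectionK k.
have := card_diagonals B piK sgK.
have adm := diagonals_admissible B piK sgK.
have : #|diagonals B pi (reflection k)| <= Tstar B by apply: (leq_bigmax_cond _ adm).
have Ycard : #|Y| <= D by case: Yl => [->|[l ? ->]] //; rewrite cards0.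
have YY : joining_columns B pi \subset Y.
  apply/subsetP => y; rewrite inE => /existsP[r /and3P[rr ry sy]].
  by apply: (subsetP (subY r rr)); rewrite !inE ry.
have exc : #|excluded B pi (reflection k)| <= #|B| + n.+1 * D.
  apply: leq_trans (leq_card_setU _ _).1 _; rewrite leq_add2l cardsX.
  by apply: leq_mul; [exact: card_joining_rows | apply: leq_trans (subset_leq_card YY) Ycard].
have ap := card_ascents piK; have as_ := card_ascents sgK.
have := card_fixed_reflection k; rewrite cardsX.
move: as_ ap fixpi exc obs.
set a := #|ascents pi|; set b := #|ascents _|; set f := #|[set c | _ == _]|; set g := #|[set r | pi r == r]|.
set o := #|[set u in corners _ _ | _]|.
move: (#|diagonals _ _ _|) (#|excluded _ _ _|) (#|_|) (Tstar _) => d e beta T.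
move=> hb ha hg he ho hf hdT hc.
(* A reflection fixes at most two columns. *)
have : (m - (D.+1 + beta)) * (n.+1 - 2) <= (2 * a) * (2 * b) by apply: leq_mul; lia.
nia.
Qed.

(** * Replacing lines by lines of a finite plane *)

Lemma injection_into (I T : finType) (Q : {set T}) : #|I| <= #|Q| ->
  exists2 f : I -> T, injective f & forall i, f i \in Q.
Proof.
move=> le; exists (fun i => enum_val (widen_ord le (enum_rank i))); last by move=> i; apply: enum_valP.
by move=> i j /enum_val_inj/(congr1 val) /= /val_inj/enum_rank_inj.
Qed.

(** [P] consists of the points on [t] vertical lines of the affine plane over [F],
    and the sets [g i] are the traces of its non-vertical lines. *)
Lemma transversal_design (F : finFieldType) (T : finType) (Q : {set T}) (t : nat) :
  t <= #|F| -> t * #|F| <= #|Q| ->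
  exists (P : {set T}) (g : F * F -> {set T}),
  [/\ P \subset Q, #|P| = t * #|F|, forall i, g i \subset P /\ #|g i| = t &
      forall i j, i != j -> #|g i :&: g j| <= 1].
Proof.
move=> tF tQ.
have [|iota iota_inj iotaQ] := @injection_into ('I_t * F)%type T Q.
  by rewrite card_prod card_ord.
have [|u u_inj _] := @injection_into 'I_t F setT; first by rewrite card_ord cardsT.
pose point (ab : F * F) i := iota (i, ab.1 * u i + ab.2)%R.
exists (iota @: setT), (fun ab => [set point ab i | i : 'I_t]); split.
- by apply/subsetP => _ /imsetP[i _ ->].
- by rewrite card_imset // cardsT card_prod card_ord.
- move=> ab; split; first by apply/subsetP => _ /imsetP[i _ ->]; apply: imset_f.
  by rewrite card_imset ?card_ord // => i j /iota_inj[].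
move=> [a b] [a' b'] ne; apply/card_le1_eqP => x y.
move=> /setIP[/imsetP[i _ ->] /imsetP[i' _ /iota_inj[<- /= ei]]].
move=> /setIP[/imsetP[j _ ->] /imsetP[j' _ /iota_inj[<- /= ej]]].
have [->//|ij] := eqVneq i j; case/eqP: ne.
(* Two lines y = a x + b and y = a' x + b' agreeing at u i and u j coincide. *)
have : ((a - a') * (u i - u j) == 0)%R.
  have -> : ((a - a') * (u i - u j) =
    (a * u i + b) - (a' * u i + b') - ((a * u j + b) - (a' * u j + b')))%R by ring.
  by rewrite ei ej !GRing.subrr.
rewrite GRing.mulf_eq0 !GRing.subr_eq0 => /orP[/eqP aa | /eqP/u_inj/eqP]; last by rewrite (negbTE ij).
by move: ei; rewrite aa => /GRing.addrI->.
Qed.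

Section Replacement.
Variables m n : nat.
Implicit Types B : {set 'I_m * 'I_n}.

(** Once [P] is removed from the line [x0], no remaining line contains two points
    of [P], so any linear family of subsets of [P] can be used for the rows of
    [A]. *)
Lemma replace_lines B (x0 : 'I_m) (P : {set 'I_n}) (A : {set 'I_m}) (h : 'I_m -> {set 'I_n}) :
  C4_free B -> P \subset line B x0 -> x0 \notin A ->
  (forall r, r \in A -> h r \subset P) ->
  (forall r s, r \in A -> s \in A -> r != s -> #|h r :&: h s| <= 1) ->
  #|B| + \sum_(r in A) #|h r| <= zar m n + \sum_(r in A) #|line B r| + #|P|.
Proof.
move=> free PB x0A hP hh; have meet := elimT (C4_freeP B) free.
pose f r := if r \in A then h r else if r == x0 then line B r :\: P else line B r.
have fB r : r \notin A -> f r \subset line B r.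
  by rewrite /f => /negbTE->; case: ifP => _ //; apply: subsetDl.
have small r s : r \in A -> s \notin A -> #|h r :&: f s| <= 1.
  move=> rA sA; rewrite /f (negbTE sA); have [-> | sx] := eqVneq s x0.
    rewrite setIDA leq_eqVlt; apply/orP; right; rewrite ltnS leqn0 cards_eq0 setD_eq0.
    by apply: subset_trans (subsetIl _ _) (hP r rA).
  apply: leq_trans (meet x0 s _); last by rewrite eq_sym.
  by apply/subset_leq_card/setSI/(subset_trans (hP r rA)).
have freef : C4_free (of_lines f).
  apply/C4_freeP => r s rs; rewrite !line_of_lines.
  have [rA|rA] := boolP (r \in A); have [sA|sA] := boolP (s \in A).
  - by rewrite {1 2}/f rA sA; apply: hh.
  - by rewrite {1}/f rA; apply: small.
  - by rewrite setIC {1}/f sA; apply: small.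
  - by apply: leq_trans (meet r s rs); apply/subset_leq_card/setISS; apply: fB.
have split_sum (F : 'I_m -> nat) :
    \sum_r F r = \sum_(r in A) F r + (F x0 + \sum_(r | (r \notin A) && (r != x0)) F r).
  by rewrite (bigID (mem A)) /=; congr (_ + _); rewrite (bigD1 x0).
have := C4_free_leq_zar freef; rewrite card_by_lines (card_by_lines B) !split_sum.
rewrite (eq_bigr (fun r => #|h r|)); last by move=> r; rewrite line_of_lines /f => ->.
rewrite line_of_lines /f (negbTE x0A) eqxx cardsDS //.
rewrite [X in _ + (_ + X) <= _ -> _](eq_bigr (fun r => #|line B r|)); last first.
  by move=> r /andP[/negbTE rA /negbTE rx]; rewrite line_of_lines rA rx.
have := subset_leq_card PB; set p := #|P|; set l := #|line B x0|; set a := \sum_(r in A) #|h r|.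
set c := \sum_(r in A) #|_|; set b := \sum_(r | _) #|_|; set z := zar _ _.
lia.
Qed.

(** Fields of order [2 ^ k] are dense enough: consecutive orders differ by a
    factor of two. *)
Lemma plane_replacement B x0 (A : {set 'I_m}) k t : C4_free B -> 0 < k -> x0 \notin A ->
  (2 ^ k) ^ 2 <= #|A| -> t <= 2 ^ k -> t * 2 ^ k <= #|line B x0| ->
  exists2 A' : {set 'I_m}, A' \subset A /\ #|A'| = (2 ^ k) ^ 2 &
    #|B| + (2 ^ k) ^ 2 * t <= zar m n + \sum_(r in A') #|line B r| + t * 2 ^ k.
Proof.
move=> free k0 x0A qA tq tx0.
have [F _ cardF] := PrimePowerField (isT : prime 2) k0; rewrite -cardF in qA tq tx0 *.
have [P [g [PB cardP gP gg]]] := transversal_design tq tx0.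
have [|psi psi_inj psiA] := @injection_into (F * F)%type _ A.
  by rewrite card_prod mulnn.
exists (psi @: setT).
  split; last by rewrite card_imset // cardsT card_prod mulnn.
  by apply/subsetP => _ /imsetP[i _ ->].
pose h r := if [pick i | psi i == r] is Some i then g i else set0.
have hpsi i : h (psi i) = g i.
  by rewrite /h; case: pickP => [j /eqP/psi_inj->|/(_ i)] //; rewrite eqxx.
have -> : #|F| ^ 2 * t = \sum_(r in psi @: setT) #|h r|.
  rewrite big_imset /=; last by move=> i j _ _; apply: psi_inj.
  rewrite (eq_bigr (fun=> t)); last by move=> i _; rewrite hpsi (gP i).2.
  by rewrite sum_nat_const cardsT card_prod mulnn.
rewrite -cardP; apply: (replace_lines free PB (h := h)).
- by apply: contra x0A => /imsetP[i _ ->].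
- by move=> _ /imsetP[i _ ->]; rewrite hpsi (gP i).1.
move=> _ _ /imsetP[i _ ->] /imsetP[j _ ->] ij; rewrite !hpsi; apply: gg.
by apply: contra_neq ij => ->.
Qed.

(** The rows of a long column have few further cells, as their lines are disjoint
    outside that column, so replacing them costs little. *)
Lemma crossing_gain B x0 y0 k t : C4_free B -> 0 < k ->
  (2 ^ k) ^ 2 < #|column B y0| -> t <= 2 ^ k -> t * 2 ^ k <= #|line B x0| ->
  #|B| + (2 ^ k) ^ 2 * t <= zar m n + (2 ^ k) ^ 2 + 2 * n.
Proof.
move=> free k0 col tq tx0.
have [| |A [Acol cardA] gain] := @plane_replacement B x0 (column B y0 :\ x0) k t free k0 _ _ tq tx0.
- by rewrite !inE eqxx.
- rewrite -ltnS; apply: leq_trans col _; rewrite (cardsD1 x0) -[in X in _ <= X]add1n.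
  by rewrite leq_add2r; case: (_ \in _).
have tqn : t * 2 ^ k <= n.
  by apply: leq_trans tx0 _; rewrite -[n in _ <= n]card_ord; apply: max_card.
have : \sum_(r in A) #|line B r| <= (2 ^ k) ^ 2 + n.
  apply: leq_trans (_ : \sum_(r in A) (1 + #|line B r|.-1) <= _).
    by apply: leq_sum => r _; rewrite add1n leqSpred.
  rewrite big_split /= sum1_card cardA leq_add2l.
  apply: leq_trans (sum_lines_through y0 free).
  rewrite [X in X <= _]big_mkcond [X in _ <= X]big_mkcond; apply: leq_sum => r _.
  by case: ifP => // /(subsetP Acol); rewrite in_setD1 => /andP[_ ->].
lia.
Qed.

(** Otherwise [(2 ^ k) ^ 2] lines of at most [K] cells can be replaced by sets of
    [K.+1] points on a long line, at the cost of [K.+1 * 2 ^ k] cells of the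
    latter, fewer than the [(2 ^ k) ^ 2] gained. *)
Lemma maximum_base_short_lines B K k : maximum_base B -> K.+1 < 2 ^ k ->
  2 * #|B| <= K * m -> 2 * (2 ^ k) ^ 2 + 2 <= m ->
  forall r, #|line B r| < K.+1 * 2 ^ k.
Proof.
move=> /andP[free /eqP max] Kk avg mbig x0; rewrite ltnNge; apply/negP => long.
have k0 : 0 < k by case: k Kk {mbig long}.
(* By the average bound at least half of the lines have at most K cells. *)
have many : m <= 2 * #|[set r | #|line B r| <= K]|.
  have : \sum_(r | ~~ (#|line B r| <= K)) K.+1 <= #|B|.
    rewrite card_by_lines big_mkcond; apply: leq_sum => r _.
    by case: ifP => //; rewrite -ltnNge.
  rewrite sum_nat_const.
  have := cardC [set r | #|line B r| <= K]; rewrite card_ord.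
  have -> : #|[predC [set r | #|line B r| <= K]]| = #|[pred r | ~~ (#|line B r| <= K)]|.
    by apply: eq_card => r; rewrite !inE.
  move: avg; set c := #|B|; set a := #|[set r | _]|; set b := #|[pred r | _]|.
  move=> avg ab bc; have : 2 * b * K.+1 <= K * m by lia.
  by move: ab; clear; nia.
have [| | |A [AS cardA]] := @plane_replacement B x0 ([set r | #|line B r| <= K] :\ x0) k K.+1 free k0 _ _ _ long.
- by rewrite !inE eqxx.
- move: many; rewrite (cardsD1 x0); set d := (_ \in _); set e := #|_ :\ _|.
  by case: d; lia.
- exact: ltnW.
have : \sum_(r in A) #|line B r| <= (2 ^ k) ^ 2 * K.
  rewrite -cardA -sum_nat_const; apply: leq_sum => r /(subsetP AS).
  by rewrite !inE => /andP[_].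
rewrite -max; move: Kk; set q := 2 ^ k; nia.
Qed.

End Replacement.

(** * An upper bound when almost all lines share a column *)

Section UpperBound.
Variables m n : nat.
Local Notation cell := ('I_m * 'I_n)%type.
Implicit Types (B : {set cell}) (E : {set {set cell}}).

(** The rows outside [Z] all contain [y0], so the sizes of the two columns of
    almost every selected pair add up to at most [m + 2]. Summing over the pairs
    and applying Cauchy-Schwarz bounds the number of selected cells. *)
Lemma Tstar_common_column B (Z : {set 'I_m}) y0 :
  (forall r, r \notin Z -> (r, y0) \in B) ->
  4 * Tstar B <= n * (m + 2) + 4 * (#|Z| * n + m).
Proof.
move=> y0B; have [E adm <-] := Tstar_attained B.
have tE : trivIset E by case/and4P: adm.
pose S : {set cell} := [set u | (u.1 \in Z) || (u.2 == y0)].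
pose E' := [set p in E | p :&: S == set0].
have tE' : trivIset E' by apply: trivIsetS tE; apply/subsetP => p; rewrite inE => /andP[].
have cardS : #|S| <= #|Z| * n + m.
  apply: leq_trans (_ : #|setX Z [set: 'I_n] :|: setX [set: 'I_m] [set y0]| <= _).
    by apply/subset_leq_card/subsetP => -[r c]; rewrite !inE andbT.
  by apply: leq_trans (leq_card_setU _ _).1 _; rewrite !cardsX !cardsT !card_ord cards1 muln1.
have cardE : #|E| <= #|E'| + #|S|.
  apply: leq_trans (leq_add (leqnn _) (card_trivIset_meeting S tE)).
  apply: leq_trans (leq_card_setU _ _).1; apply/subset_leq_card/subsetP => p pE.
  by rewrite !inE pE; case: (_ == _).
(* g c + g d <= m + 2 for a pair of E' in columns c and d: a third row x
   containing both would complete a domino at (x, y0). *)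
pose g c := #|column (cover E') c|.
have cardp p : p \in E' -> #|p| = 2.
  rewrite inE => /andP[pE _]; have [u [v [-> uv _ _]]] := admissible_pairE adm pE.
  by rewrite cards2 uv.
have sumg : \sum_c g c = 2 * #|E'|.
  have /eqP : #|cover E'| == \sum_(p in E') #|p| by rewrite (leq_card_cover E').2.
  rewrite (eq_bigr (fun=> 2)) ?sum_nat_const; last by move=> p; apply: cardp.
  by rewrite mulnC => <-; rewrite card_by_columns.
have pairg p : p \in E' -> \sum_(u in p) g u.2 <= m + 2.
  rewrite inE => /andP[pE /eqP/setP pS]; have [u [v [def uv uB vB]]] := admissible_pairE adm pE.
  rewrite def big_setU1 ?inE //= big_set1 /g.
  set X := column _ u.2; set X' := column _ v.2.
  have [uS vS] : u \notin S /\ v \notin S.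
    by split; [have := pS u | have := pS v]; rewrite def in_setI !inE eqxx ?orbT /= => ->.
  have sub x c : (x, c) \in cover E' -> [/\ (x, c) \in occupied B E, (x, y0) \in occupied B E & c != y0].
    case/bigcupP => q; rewrite inE => /andP[qE /eqP/setP/(_ (x, c)) + xq].
    rewrite in_setI xq !inE /= => /negbT; rewrite negb_or => /andP[xZ cy].
    split; rewrite ?y0B //.
    by apply/orP; right; apply/bigcupP; exists q.
  move: uS vS; rewrite !inE !negb_or => /andP[uZ uy] /andP[vZ vy].
  have : #|X :&: X'| <= 2.
    apply: leq_trans (_ : #|[set u.1; v.1]| <= _); last by rewrite cards2; case: (_ != _).
    apply/subset_leq_card/subsetP => x; rewrite !inE => /andP[/sub[xu xy uy0] /sub[xv _ _]].
    apply: contraT; rewrite negb_or => /andP[xu1 xv1]; exfalso.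
    rewrite def in pE.
    apply: (admissible_no_domino adm pE xu1 xv1 _ _ xy xu xv); rewrite 1?[y0 == _]eq_sym //.
      by rewrite inE y0B.
    by rewrite inE y0B.
  have : #|X :|: X'| <= m by rewrite -[m in _ <= m]card_ord max_card.
  have := cardsU X X'; have := subset_leq_card (subsetIl X X').
  by move: #|_ :|: _| #|_ :&: _| #|X| #|X'| => a b c d; clear; lia.
have sq : \sum_c g c ^ 2 <= #|E'| * (m + 2).
  apply: leq_trans (_ : \sum_(p in E') \sum_(u in p) g u.2 <= _); last first.
    by rewrite -sum_nat_const; apply: leq_sum => p pE; apply: pairg.
  rewrite -(big_trivIset _ tE') /= big_by_columns /=; apply: leq_sum => c _.
  by rewrite sum_nat_const -mulnn.
have := sqr_sum_le g; rewrite sumg card_ord.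
have : n * \sum_c g c ^ 2 <= n * (#|E'| * (m + 2)) by rewrite leq_mul2l sq orbT.
move: cardE cardS; set e := #|E'|; set a := #|E|; set b := #|S|; set z := #|Z| * n + m.
move=> cE cS le1 le2; have le3 := leq_trans le2 le1.
have : 4 * e <= n * (m + 2).
  case: (posnP e) => [-> //|e0]; rewrite -(leq_pmul2l e0).
  by move: le3; rewrite -mulnn mulnACA mulnn mulnCA [e * (n * _)]mulnCA mulnC; lia.
lia.
Qed.
End UpperBound.

(** * Two maximum bases of a wide matrix *)

Section PairBase.
Variables (m n : nat) (h : 'I_m -> 'I_n).

Definition pairs : seq {set 'I_n} := enum [set P : {set 'I_n} | #|P| == 2].

Lemma size_pairs : size pairs = 'C(n, 2).
Proof. by rewrite -cardE card_draws card_ord. Qed.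

(** The first ['C(n, 2)] lines are the pairs of columns, the other lines are the
    singletons prescribed by [h]. *)
Definition pair_base : {set 'I_m * 'I_n} :=
  of_lines (fun r : 'I_m => nth [set h r] pairs r).

Lemma line_pair_base_long (r : 'I_m) : 'C(n, 2) <= r -> line pair_base r = [set h r].
Proof. by move=> le; rewrite line_of_lines nth_default // size_pairs. Qed.

Lemma card_line_pair_base_short (r : 'I_m) : r < 'C(n, 2) -> #|line pair_base r| = 2.
Proof.
rewrite -size_pairs => lt; rewrite line_of_lines; apply/eqP.
by have := mem_nth [set h r] lt; rewrite mem_enum inE.
Qed.

(** All pairs of columns are used, and no line has more than two cells, so the
    inequalities behind [zar_leq] are equalities. *)
Lemma pair_base_maximum : 'C(n, 2) <= m -> maximum_base pair_base.
Proof.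
move=> Nm; have free : C4_free pair_base.
  apply/C4_freeP => r s rs.
  have [rN|rN] := leqP 'C(n, 2) r.
    rewrite line_pair_base_long //; apply: leq_trans (subset_leq_card (subsetIl _ _)) _.
    by rewrite cards1.
  have [sN|sN] := leqP 'C(n, 2) s.
    rewrite [line _ s]line_pair_base_long //; apply: leq_trans (subset_leq_card (subsetIr _ _)) _.
    by rewrite cards1.
  rewrite leqNgt; apply/negP => two; move/eqP: rs; apply; apply: val_inj => /=.
  have c2 (x : 'I_m) : x < 'C(n, 2) -> #|line pair_base x| = 2 by apply: card_line_pair_base_short.
  have eqr : line pair_base r :&: line pair_base s = line pair_base r.
    by apply/eqP; rewrite eqEcard subsetIl c2.
  have eqs : line pair_base r :&: line pair_base s = line pair_base s.
    by apply/eqP; rewrite eqEcard subsetIr c2.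
  have : line pair_base r = line pair_base s by rewrite -eqr eqs.
  rewrite !line_of_lines (set_nth_default set0) ?size_pairs // [RHS](set_nth_default set0) ?size_pairs //.
  by move/eqP; rewrite nth_uniq ?size_pairs ?enum_uniq // => /eqP.
rewrite /maximum_base free eqn_leq C4_free_leq_zar //=.
apply: leq_trans (zar_leq m n) _; rewrite card_by_lines.
apply: leq_trans (_ : \sum_(r : 'I_m) (1 + (r < 'C(n, 2))) <= _).
  rewrite big_split /= sum1_card card_ord leq_add2l.
  rewrite -[X in X <= _]card_ord -sum1_card (big_ord_widen m (fun=> 1)) // big_mkcond.
  by apply: leq_sum => r _; case: (_ < _).
apply: leq_sum => r _; case: ltnP => rN; first by rewrite card_line_pair_base_short.
by rewrite line_pair_base_long // cards1.
Qed.

End PairBase.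

Section ThreeBlocks.
Variables m n q p : nat.
Variables (B : {set 'I_m * 'I_n}).
Variables (row : 'I_3 -> 'I_q -> 'I_m) (col : 'I_3 -> 'I_p -> 'I_n) (special : 'I_3 -> 'I_n).
Hypothesis row_inj : forall i j a b, row i a = row j b -> i = j /\ a = b.
Hypothesis col_inj : forall i j a b, col i a = col j b -> i = j /\ a = b.
Hypothesis special_inj : injective special.
Hypothesis special_col : forall i j b, special i != col j b.
Hypothesis line_row : forall i a, line B (row i a) = [set special i].
Hypothesis line_other : forall x, (forall i a, x != row i a) -> #|line B x| <= 2.

Import GRing.Theory.
Local Notation index := ('I_3 * 'I_q * 'I_p)%type.
Implicit Types (t : index).

Definition block_cell t (i j : 'I_3) : 'I_m * 'I_n := (row i t.1.2, col j t.2).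
(** Block [(i, j)] is paired with block [(j, i)]. The pairs [{i, j}] are indexed
    by their complement [k] in the cyclic group of order three, as
    [{k + 1, k + 2}]. *)
Definition block_pair t := [set block_cell t (t.1.1 + 1)%R (t.1.1 + 2%:R)%R; block_cell t (t.1.1 + 2%:R)%R (t.1.1 + 1)%R].
Definition three_block_pairs := [set block_pair t | t : index].

Lemma block_cell_inj t t' i j i' j' : block_cell t i j = block_cell t' i' j' ->
  [/\ i = i', j = j', t.1.2 = t'.1.2 & t.2 = t'.2].
Proof. by case=> /row_inj[-> ->] /col_inj[-> ->]. Qed.

(** The sum [i + j] identifies the pair of blocks, independently of the order. *)
Lemma mem_block_pair t u : u \in block_pair t -> exists i j,
  [/\ u = block_cell t i j, i != j & (i + j = t.1.1 + t.1.1)%R].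
Proof.
rewrite !inE => /orP[] /eqP ->; [exists (t.1.1 + 1)%R, (t.1.1 + 2%:R)%R | exists (t.1.1 + 2%:R)%R, (t.1.1 + 1)%R]; split=> //.
- by rewrite (inj_eq (addrI _)).
- by rewrite addrACA -[RHS]addr0; congr (_ + _)%R; apply: val_inj.
- by rewrite (inj_eq (addrI _)).
- by rewrite addrACA -[RHS]addr0; congr (_ + _)%R; apply: val_inj.
Qed.

Lemma block_pair_disjoint t t' u : u \in block_pair t -> u \in block_pair t' -> t = t'.
Proof.
move=> /mem_block_pair[i [j [-> ij e]]] /mem_block_pair[i' [j' [/block_cell_inj[<- <- a b] _ e']]].
case: t t' e e' a b => [[k a] b] [[k' a'] b'] /= e e' -> ->; congr (_, _, _).
have {e'}e : (k + k = k' + k')%R by rewrite -e -e'.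
by apply/eqP; move/eqP: e; move: k k' {ij i j i' j'}; do 2!case=> [[|[|[|?]]]?] //.
Qed.

Lemma block_pair_cells r c s d : [set (r, c); (s, d)] \in three_block_pairs ->
  exists t i j, [/\ i != j, (r, c) = block_cell t i j & (s, d) = block_cell t j i].
Proof.
case/imsetP => t _ /setP eqp.
set i := (t.1.1 + 1)%R; set j := (t.1.1 + 2%:R)%R.
have ij : i != j by rewrite (inj_eq (addrI _)).
have vv : block_cell t i j != block_cell t j i by apply: contra_neq ij => /block_cell_inj[].
have := eqp (r, c); have := eqp (s, d); have := eqp (block_cell t i j); have := eqp (block_cell t j i).
rewrite !in_set2 !eqxx ?orbT /= => e1 e2 /esym/orP e3 /esym/orP e4.
case: e4 => /eqP rc.
  exists t, i, j; split=> //; case: e3 => /eqP sd //.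
  by move: e1; rewrite rc sd orbb eq_sym (negbTE vv).
exists t, j, i; split; rewrite 1?eq_sym //; case: e3 => /eqP sd //.
by move: e2; rewrite rc sd orbb (negbTE vv).
Qed.

Lemma three_block_cell x z : (x, z) \in occupied B three_block_pairs ->
  (x, z) \in B \/ exists t i j, i != j /\ (x, z) = block_cell t i j.
Proof.
rewrite inE => /orP[|/bigcupP[_ /imsetP[t _ ->] /mem_block_pair[i [j [-> ij _]]]]]; first by left.
by right; exists t, i, j.
Qed.

Lemma three_block_row i a z : (row i a, z) \in occupied B three_block_pairs ->
  z = special i \/ exists2 j, i != j & exists b, z = col j b.
Proof.
case/three_block_cell => [xB|[t [i' [j [ij [/row_inj[-> _] ->]]]]]].
  by left; apply/eqP; rewrite -in_set1 -(line_row i a) inE.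
by right; exists j => //; exists t.2.
Qed.

Lemma three_block_diagonal i a b : (row i a, col i b) \in occupied B three_block_pairs = false.
Proof.
apply/negP => /three_block_row[e|[j ij [b' /col_inj[e _]]]].
  by move: (special_col i i b); rewrite e eqxx.
by rewrite e eqxx in ij.
Qed.

Lemma third_class (i j k : 'I_3) : i != j -> k != i -> k != j ->
  forall l, [|| l == i, l == j | l == k].
Proof. by move: i j k; do 3!case=> [[|[|[|?]]]?] //; move=> _ _ _ [[|[|[|?]]]?]. Qed.

(** The rows of class [i] avoid the columns of class [i], and the special columns
    of the three row classes differ. *)
Lemma three_block_no_common i j k a a' a'' z : i != j -> k != i -> k != j ->
  (row i a, z) \in occupied B three_block_pairs -> (row j a', z) \in occupied B three_block_pairs ->
  (row k a'', z) \in occupied B three_block_pairs -> False.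
Proof.
move=> ij ki kj /three_block_row[zi|[l il [b zl]]] /three_block_row[zj|[l' jl [b' zl']]] /three_block_row[zk|[l'' kl [b'' zl'']]].
- by move/eqP: ij; apply; apply: special_inj; rewrite -zi.
- by move/eqP: ij; apply; apply: special_inj; rewrite -zi.
- by move/eqP: (special_col i l' b'); rewrite -zi.
- by move/eqP: (special_col i l' b'); rewrite -zi.
- by move/eqP: (special_col j l b); rewrite -zj.
- by move/eqP: (special_col j l b); rewrite -zj.
- by move/eqP: (special_col k l b); rewrite -zk.
move: zl' zl''; rewrite zl => /col_inj[e _] /col_inj[e' _]; rewrite -{}e in jl; rewrite -{}e' in kl.
by case/or3P: (third_class ij ki kj l) il jl kl => /eqP->; rewrite eqxx.
Qed.

(** A row [x] containing columns of both classes [i] and [j] either has no third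
    cell or belongs to the third row class, and rows of the three classes have no
    common column. *)
Lemma three_block_admissible : admissible B three_block_pairs.
Proof.
apply/and4P; split.
- apply/forall_inP => _ /imsetP[t _ ->]; apply/andP; split.
    rewrite cards2 (_ : _ != _) //; by apply/eqP => /block_cell_inj[/addrI].
  apply/subsetP => u /mem_block_pair[i [j [-> ij _]]]; rewrite inE.
  apply/negP => uB; have : col j t.2 \in [set special i].
    by rewrite -(line_row i t.1.2) inE.
  by rewrite inE eq_sym (negbTE (special_col _ _ _)).
- apply/trivIsetP => _ _ /imsetP[t _ ->] /imsetP[t' _ ->] tt'; apply/pred0P => u /=.
  apply/negP => /andP[ut ut']; move/eqP: tt'; apply.
  by rewrite (block_pair_disjoint ut ut').
- apply/forallP => r; apply/forallP => c; apply/forallP => s; apply/forallP => d.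
  apply/implyP => /and3P[/block_pair_cells[t [i [j [ij [-> ->] [-> ->]]]]] _ _].
  by rewrite three_block_diagonal.
apply/forallP => r; apply/forallP => c; apply/forallP => s; apply/forallP => d.
apply/implyP => /block_pair_cells[t [i [j [ij [-> ->] [-> ->]]]]].
apply/forallP => x; apply/forallP => y; apply/implyP => /and4P[xr xs yc yd].
rewrite -!negb_and; apply/negP => /and5P[xy xc xd ry sy].
have [/existsP[k /existsP[a /eqP def]] | other] := boolP [exists k, exists a, x == row k a].
  rewrite def in xy xc xd.
  have ki : k != i.
    by apply/eqP => e; move: xd; rewrite e three_block_diagonal.
  have kj : k != j.
    by apply/eqP => e; move: xc; rewrite e three_block_diagonal.
  exact: (three_block_no_common ij ki kj ry sy xy).
have others k a : x != row k a.
  by apply: contra other => xa; apply/existsP; exists k; apply/existsP; exists a.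
have inB z : (x, z) \in occupied B three_block_pairs -> z \in line B x.
  case/three_block_cell => [|[t' [i' [j' [_ [e _]]]]]]; first by rewrite inE.
  by case/eqP: (others i' t'.1.2).
have := line_other others; rewrite leqNgt => /negP; apply.
have sub : [set y; col j t.2; col i t.2] \subset line B x.
  by apply/subsetP => z; rewrite !in_setU !in_set1 -orbA => /or3P[] /eqP->; apply: inB.
apply: leq_trans (subset_leq_card sub).
rewrite -setUA cardsU1 cards2 !inE negb_or yc yd /=.
by rewrite (_ : col j t.2 != col i t.2) //; apply: contra_neq ij => /col_inj[].
Qed.

Lemma card_three_block_pairs : #|three_block_pairs| = 3 * q * p.
Proof.
rewrite card_in_imset ?card_prod ?card_ord // => t t' _ _ /setP/(_ (block_cell t (t.1.1 + 1)%R (t.1.1 + 2%:R)%R)).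
rewrite {1}/block_pair in_set2 eqxx /= => /esym; apply: block_pair_disjoint.
by rewrite in_set2 eqxx.
Qed.

End ThreeBlocks.

Lemma mixed_radix_inj q i j a b : a < q -> b < q -> i * q + a = j * q + b -> i = j /\ a = b.
Proof.
move=> aq bq e; have q0 : 0 < q by lia.
have := congr1 (divn^~ q) e; rewrite !divnMDl // !divn_small // !addn0 => ij.
by split=> //; move: e; rewrite ij => /addnI.
Qed.

(** The special columns carry the singletons of the base. A single
    column common to all three row classes would limit [Tstar] to a quarter of
    the matrix by [Tstar_common_column]. *)
Lemma three_block_base m n : 3 <= n -> 'C(n, 2) <= m ->
  exists2 B : {set 'I_m * 'I_n}, maximum_base B &
    3 * ((m - 'C(n, 2)) %/ 3) * ((n - 3) %/ 3) <= Tstar B.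
Proof.
case: n => // n n3 Nm; have N0 : 0 < 'C(n.+1, 2) by rewrite bin_gt0; lia.
case: m Nm => [|m] Nm; first by lia.
set q := (m.+1 - _) %/ 3; set p := (n.+1 - 3) %/ 3; set N := 'C(n.+1, 2).
have Nq : N + 3 * q <= m.+1 by have := leq_trunc_div (m.+1 - N) 3; rewrite -/q; lia.
have np : 3 * p + 3 <= n.+1 by have := leq_trunc_div (n.+1 - 3) 3; rewrite -/p; lia.
clearbody q p.
pose row (i : 'I_3) (a : 'I_q) : 'I_m.+1 := inord (N + (i * q + a)).
pose col (j : 'I_3) (b : 'I_p) : 'I_n.+1 := inord (j * p + b).
pose special (i : 'I_3) : 'I_n.+1 := inord (3 * p + i).
have rowE i a : row i a = N + (i * q + a) :> nat.
  by rewrite inordK //; have := ltn_ord i; have := ltn_ord a; nia.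
have colE j b : col j b = j * p + b :> nat.
  by rewrite inordK //; have := ltn_ord j; have := ltn_ord b; nia.
have specialE i : special i = 3 * p + i :> nat.
  by rewrite inordK //; have := ltn_ord i; lia.
pose h (r : 'I_m.+1) : 'I_n.+1 := special (inord ((r - N) %/ q)).
have row_inj i j a b : row i a = row j b -> i = j /\ a = b.
  move/(congr1 val); rewrite /= !rowE => /addnI e.
  by have [ij ab] := mixed_radix_inj (ltn_ord a) (ltn_ord b) e; split; apply: val_inj.
have col_inj i j a b : col i a = col j b -> i = j /\ a = b.
  move/(congr1 val); rewrite /= !colE => e.
  by have [ij ab] := mixed_radix_inj (ltn_ord a) (ltn_ord b) e; split; apply: val_inj.
have special_inj : injective special.
  by move=> i j /(congr1 val); rewrite /= !specialE => /addnI/val_inj.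
have special_col i j b : special i != col j b.
  apply/eqP => /(congr1 val); rewrite /= specialE colE.
  by have := ltn_ord j; have := ltn_ord b; nia.
have line_row i a : line (pair_base h) (row i a) = [set special i].
  rewrite line_pair_base_long; last by rewrite rowE leq_addr.
  congr [set special _]; rewrite rowE addKn divnMDl; last by have := ltn_ord a; lia.
  by rewrite divn_small // addn0 inord_val.
have line_other x : #|line (pair_base h) x| <= 2.
  have [le|lt] := leqP N x; first by rewrite line_pair_base_long // cards1.
  by rewrite card_line_pair_base_short.
exists (pair_base h); first exact: pair_base_maximum.
rewrite -(card_three_block_pairs row_inj col_inj); apply: leq_bigmax_cond.
apply: (three_block_admissible row_inj col_inj special_inj special_col line_row).
by move=> x _; apply: line_other.
Qed.

Lemma one_column_base m n : 2 <= n -> 'C(n, 2) <= m ->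
  exists2 B : {set 'I_m * 'I_n}, maximum_base B &
    4 * Tstar B <= n * (m + 2) + 4 * ('C(n, 2) * n + m).
Proof.
case: n => // n n2 Nm; pose h (r : 'I_m) : 'I_n.+1 := ord0.
exists (pair_base h); first exact: pair_base_maximum.
pose Z := [set r : 'I_m | r < 'C(n.+1, 2)].
have cardZ : #|Z| <= 'C(n.+1, 2).
  rewrite -[X in _ <= X]card_ord -!sum1_card (big_ord_widen m (fun=> 1)) //.
  by rewrite big_mkcond [X in _ <= X]big_mkcond; apply: leq_sum => r _; rewrite inE.
apply: leq_trans (_ : n.+1 * (m + 2) + 4 * (#|Z| * n.+1 + m) <= _).
  apply: (@Tstar_common_column _ _ _ Z ord0) => r; rewrite inE -leqNgt => rN.
  by have := line_pair_base_long h rN => /setP/(_ ord0); rewrite !inE eqxx.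
by rewrite leq_add2l leq_mul2l leq_add2r leq_mul2r cardZ orbT.
Qed.

(** * Transposition *)

Section Transpose.
Variables m n : nat.
Implicit Types (A B : {set 'I_m * 'I_n}) (E : {set {set 'I_m * 'I_n}}).

Definition transpose A : {set 'I_n * 'I_m} := [set u | (u.2, u.1) \in A].

Lemma card_transpose A : #|transpose A| = #|A|.
Proof.
rewrite card_by_lines card_by_columns; apply: eq_bigr => c _.
by apply: eq_card => r; rewrite !inE.
Qed.

Lemma C4_free_transpose A : C4_free A -> C4_free (transpose A).
Proof.
move=> free; apply/C4_freeP => c d cd; apply/card_le1_eqP => r s; rewrite !inE /=.
move=> /andP[rc rd] /andP[sc sd].
exact: (two_columns_meet_once free cd sc rc sd rd).
Qed.

Lemma transpose_set2 r c s d :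
  transpose [set (r, c); (s, d)] = [set (c, r); (d, s)].
Proof. by apply/setP => -[x y]; rewrite !inE /= !xpair_eqE ![(x == _) && _]andbC. Qed.

End Transpose.

Lemma transposeK m n : cancel (@transpose m n) (@transpose n m).
Proof. by move=> A; apply/setP => -[r c]; rewrite !inE. Qed.

Lemma zar_transpose m n : zar n m = zar m n.
Proof.
suff le k l : zar k l <= zar l k by apply/eqP; rewrite eqn_leq !le.
apply/bigmax_leqP => A free; rewrite -card_transpose.
exact/C4_free_leq_zar/C4_free_transpose.
Qed.

Lemma maximum_base_transpose m n (B : {set 'I_m * 'I_n}) :
  maximum_base B -> maximum_base (transpose B).
Proof.
by rewrite /maximum_base card_transpose zar_transpose => /andP[/C4_free_transpose-> ->].
Qed.

Lemma admissible_transpose m n (B : {set 'I_m * 'I_n}) E :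
  admissible B E -> admissible (transpose B) (@transpose m n @: E).
Proof.
have inj := can_inj (@transposeK m n).
move=> adm; case/and4P: (adm) => /forall_inP sel tE C2 C3.
have mem_cov u : (u \in cover (@transpose m n @: E)) = ((u.2, u.1) \in cover E).
  apply/bigcupP/bigcupP => [[_ /imsetP[p pE ->]] | [p pE up]].
    by rewrite inE => up; exists p.
  by exists (transpose p); [apply: imset_f | rewrite inE].
have occ x y : ((x, y) \in occupied (transpose B) (@transpose m n @: E)) = ((y, x) \in occupied B E).
  by rewrite !inE mem_cov.
have memE c r d s : [set (c, r); (d, s)] \in @transpose m n @: E -> [set (r, c); (s, d)] \in E.
  by rewrite -transpose_set2 mem_imset.
apply/and4P; split.
- apply/forall_inP => _ /imsetP[p /sel/andP[p2 /subsetP pB] ->].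
  rewrite card_transpose p2; apply/subsetP => u; rewrite !inE => /pB.
  by rewrite inE.
- apply/trivIsetP => _ _ /imsetP[p pE ->] /imsetP[q qE ->] pq.
  have /trivIsetP/(_ _ _ pE qE) := tE; rewrite (contra_neq _ pq) => [/(_ isT) /pred0P dis|-> //].
  by apply/pred0P => u; have := dis (u.2, u.1); rewrite /= !inE.
- apply/forallP => c; apply/forallP => r; apply/forallP => d; apply/forallP => s.
  apply/implyP => /and3P[/memE pE cd rs]; rewrite !occ andbC.
  move: C2 => /forallP/(_ r)/forallP/(_ c)/forallP/(_ s)/forallP/(_ d)/implyP; apply.
  by rewrite pE rs cd.
apply/forallP => c; apply/forallP => r; apply/forallP => d; apply/forallP => s.
apply/implyP => /memE pE; apply/forallP => y; apply/forallP => x; apply/implyP.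
move=> /and4P[yc yd xr xs]; rewrite !occ -!negb_and; apply/negP => /and5P[xy ry sy xc xd].
exact: (admissible_no_domino adm pE xr xs yc yd xy xc xd ry sy).
Qed.

Lemma Tstar_transpose m n (B : {set 'I_m * 'I_n}) : Tstar (transpose B) = Tstar B.
Proof.
suff le k l (A : {set 'I_k * 'I_l}) : Tstar A <= Tstar (transpose A).
  by apply/eqP; rewrite eqn_leq le -{2}[B]transposeK le.
have [E adm <-] := Tstar_attained A.
rewrite -(card_imset _ (can_inj (@transposeK k l))).
exact/leq_bigmax_cond/admissible_transpose.
Qed.

Import Order.TTheory GRing.Theory Num.Theory.

(** * An upper bound for every base *)

Section Third.
Variables m n : nat.
Local Notation cell := ('I_m * 'I_n)%type.
Implicit Types (B O : {set cell}) (E : {set {set cell}}).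

Definition overlap O x r := #|line O r :&: line O x|.

Local Open Scope ring_scope.

(** The charge that the cell [u] receives from the row [x]: cells outside the
    columns of [x] get 1, the others an amount decreasing in the overlap of
    their line with that of [x]. For two selected cells in the columns of [x], the
    overlaps add up to at most [#|line O x| + 2], and by the convexity of the
    inverse the charges add up to at least 1. *)
Definition charge O x (u : cell) : rat :=
  if u.2 \in line O x then (#|line O x| + 2)%:R / (2 * (overlap O x u.1)%:R) - 1 / 2 else 1.

Lemma overlap_gt0 O x (u : cell) : u \in O -> u.2 \in line O x -> (0 < overlap O x u.1)%N.
Proof.
case: u => r c rc cx; rewrite card_gt0; apply/set0Pn; exists c.
by rewrite inE cx andbT inE.
Qed.

Lemma charge_ge0 O x u : u \in O -> 0 <= charge O x u.
Proof.
move=> uO; rewrite /charge; case: ifP => // ux; have a0 := overlap_gt0 uO ux.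
have : (overlap O x u.1 <= #|line O x|)%N by apply/subset_leq_card/subsetIr.
move: a0; rewrite natrD -(ltr0n rat) -(ler_nat rat).
move: (overlap _ _ _)%:R #|_|%:R => a w a0 le.
rewrite subr_ge0 ler_pdivlMr; last by lra.
by lra.
Qed.

Lemma charge_pair B E x u v : admissible B E -> [set u; v] \in E ->
  x != u.1 -> x != v.1 ->
  1 <= charge (occupied B E) x u + charge (occupied B E) x v.
Proof.
move=> adm pE xu xv; set O := occupied B E.
have cov w : w \in [set u; v] -> w \in O.
  by move=> wp; rewrite inE; apply/orP; right; apply/bigcupP; exists [set u; v].
have uO : u \in O by apply: cov; rewrite !inE eqxx.
have vO : v \in O by apply: cov; rewrite !inE eqxx orbT.
have cu := charge_ge0 x uO; have cv := charge_ge0 x vO.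
have [ux|ux] := boolP (u.2 \in line O x); last by rewrite {1}/charge (negbTE ux) lerDl.
have [vx|vx] := boolP (v.2 \in line O x); last by rewrite {2}/charge (negbTE vx) lerDr.
have a0 := overlap_gt0 uO ux; have b0 := overlap_gt0 vO vx.
rewrite /charge ux vx.
have : (overlap O x u.1 + overlap O x v.1 <= #|line O x| + 2)%N.
  rewrite /overlap; set X := _ :&: _; set X' := _ :&: _.
  have : (#|X :|: X'| <= #|line O x|)%N by apply/subset_leq_card; rewrite subUset !subsetIr.
  have : (#|X :&: X'| <= 2)%N.
    apply: leq_trans (_ : #|[set u.2; v.2]| <= _)%N; last by rewrite cards2; case: (_ != _).
    apply/subset_leq_card/subsetP => y; rewrite !inE => /andP[/andP[uy xy] /andP[vy _]].
    apply: contraT; rewrite negb_or => /andP[yu yv]; exfalso.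
    rewrite !inE in ux vx.
    by apply: (admissible_no_domino adm pE xu xv yu yv); rewrite -/O ?inE.
  by have := cardsU X X'; have := subset_leq_card (subsetIl X X'); lia.
move: a0 b0; rewrite -!(ltr0n rat) -(ler_nat rat) natrD.
move: (overlap _ _ _)%:R (overlap _ _ _)%:R (_ + 2)%N%:R => a b w a0 b0 le.
suff : 2 <= w / (2 * a) + w / (2 * b) by lra.
have -> : w / (2 * a) + w / (2 * b) = w * (a + b) / (2 * a * b).
  by field; lra.
rewrite ler_pdivlMr; last by rewrite !mulr_gt0.
rewrite -subr_ge0.
have -> : w * (a + b) - 2 * (2 * a * b) = (w - (a + b)) * (a + b) + (a - b) ^+ 2 by ring.
by rewrite addr_ge0 ?sqr_ge0 // mulr_ge0; lra.
Qed.

(** The cells of one row in the columns of [x] are as many as the overlap, which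
    cancels the denominator in their charge. *)
Lemma sum_charge O x : \sum_(u in O) charge O x u <=
  \sum_r (#|line O r|%:R + (#|line O x| + 2)%:R / 2 - 3 / 2 * (overlap O x r)%:R).
Proof.
rewrite big_by_lines; apply: ler_sum => r _.
rewrite (bigID (mem (line O x))) /=.
rewrite (eq_bigr (fun=> (#|line O x| + 2)%:R / (2 * (overlap O x r)%:R) - 1 / 2)); last first.
  by move=> c /andP[_ cx]; rewrite /charge /= cx.
rewrite [X in _ + X <= _](eq_bigr (fun=> 1)); last first.
  by move=> c /andP[_ /negbTE cx]; rewrite /charge /= cx.
rewrite (eq_bigl (fun c => c \in line O r :&: line O x)); last by move=> c; rewrite in_setI.
rewrite [X in _ + X <= _](eq_bigl (fun c => c \in line O r :\: line O x)); last by move=> c; rewrite in_setD andbC.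
rewrite !sumr_const -/(overlap O x r).
have : (overlap O x r + #|line O r :\: line O x| = #|line O r|)%N by rewrite /overlap cardsID.
move=> /(congr1 (fun k => k%:R : rat)); rewrite natrD => <-.
move: (overlap O x r) => a; rewrite -[X in X + _ <= _]mulr_natl.
have W0 : 0 <= (#|line O x| + 2)%:R :> rat by apply: ler0n.
case: a => [|a]; first by rewrite mul0r; lra.
have a0 : a.+1%:R != 0 :> rat by rewrite pnatr_eq0.
move: a.+1%:R (#|line O x| + 2)%:R a0 W0 => b w b0 w0.
have -> : b * (w / (2 * b) - 1 / 2) = w / 2 - b / 2 by field.
lra.
Qed.

Lemma card_le_charge B E x : admissible B E ->
  #|E|%:R <= n%:R + \sum_(u in occupied B E) charge (occupied B E) x u.
Proof.
move=> adm; have tE : trivIset E by case/and4P: adm.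
pose S : {set cell} := setX [set x] [set: 'I_n].
pose E' := [set p in E | p :&: S == set0].
have cardE : (#|E| <= #|E'| + n)%N.
  have cS : #|S| = n by rewrite cardsX cards1 cardsT card_ord mul1n.
  apply: leq_trans (_ : (#|E'| + #|S|)%N <= _)%N; last by rewrite cS.
  apply: leq_trans (leq_add (leqnn _) (card_trivIset_meeting S tE)).
  apply: leq_trans (leq_card_setU _ _).1; apply/subset_leq_card/subsetP => p pE.
  by rewrite !inE pE; case: (_ == _).
have tE' : trivIset E' by apply: trivIsetS tE; apply/subsetP => p; rewrite inE => /andP[].
have : \sum_(p in E') 1 <= \sum_(p in E') \sum_(u in p) charge (occupied B E) x u.
  apply: ler_sum => p; rewrite inE => /andP[pE /eqP/setP pS].
  have [u [v [def uv _ _]]] := admissible_pairE adm pE.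
  rewrite def big_setU1 ?inE //= big_set1; rewrite def in pE.
  have off w : w \in p -> x != w.1.
    by move=> wp; have := pS w; rewrite in_setI wp !inE andbT eq_sym /= => ->.
  by apply: (charge_pair adm pE); apply: off; rewrite def !inE eqxx ?orbT.
rewrite -(big_trivIset _ tE') /= sumr_const => le.
have : \sum_(u in cover E') charge (occupied B E) x u <= \sum_(u in occupied B E) charge (occupied B E) x u.
  have sub : cover E' \subset occupied B E.
    apply/subsetP => u /bigcupP[p]; rewrite !inE => /andP[pE _] up.
    by apply/orP; right; apply/bigcupP; exists p.
  rewrite [X in _ <= X](big_setID (cover E')) /= (setIidPr sub) lerDl.
  by apply: sumr_ge0 => u /setDP[uO _]; apply: charge_ge0.
have : #|E|%:R <= #|E'|%:R + n%:R :> rat by rewrite -natrD ler_nat.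
by move: le; rewrite -mulr_natl mulr1; lra.
Qed.

(** Both sides count the triples of two rows and a column containing both. *)
Lemma sum_overlap O : (\sum_x \sum_r overlap O x r = \sum_c #|column O c| ^ 2)%N.
Proof.
rewrite (eq_bigr (fun x => \sum_r \sum_c ((r, c) \in O) * ((x, c) \in O)))%N; last first.
  move=> x _; apply: eq_bigr => r _; rewrite /overlap -sum1_card big_mkcond.
  by apply: eq_bigr => c _; rewrite !inE; do 2!case: (_ \in O).
under eq_bigr => x _ do rewrite exchange_big.
rewrite exchange_big /=; apply: eq_bigr => c _.
have -> : #|column O c| = (\sum_r ((r, c) \in O))%N.
  by rewrite -sum1_card big_mkcond; apply: eq_bigr => r _; rewrite inE; case: (_ \in O).
rewrite -mulnn big_distrlr /=; apply: eq_bigr => x _; apply: eq_bigr => r _.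
by rewrite mulnC.
Qed.

(** Summing over [x] the bound of [#|E|] by charges and applying Cauchy-Schwarz to
    the columns gives [T <= 3/2 (o - o^2 / (m n))] up to [m + n], where [o >= 2 T]
    is the number of occupied cells. As the right-hand side decreases for
    [o >= m n / 2], one may take [o = 2 T], whence [T <= m n / 3 + O(m + n)]. *)
Lemma Tstar_upper B : (3 * Tstar B <= m * n + 3 * (m + n))%N.
Proof.
have [E adm <-] := Tstar_attained B; set O := occupied B E.
have T2 : (2 * #|E| <= #|O|)%N.
  apply: leq_trans (subset_leq_card (subsetUr _ _)).
  have tE : trivIset E by case/and4P: adm.
  have /eqP -> : #|cover E| == (\sum_(p in E) #|p|)%N by rewrite (leq_card_cover E).2.
  rewrite (eq_bigr (fun=> 2%N)) ?sum_nat_const 1?mulnC //.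
  by move=> p pE; have [u [v [-> uv _ _]]] := admissible_pairE adm pE; rewrite cards2 uv.
have cardC : (#|{: cell}| = m * n)%N by rewrite card_prod !card_ord.
have OmN : (#|O| <= m * n)%N by rewrite -cardC max_card.
have C : ((#|O| ^ 2)%:R <= n%:R * (\sum_x \sum_r overlap O x r)%:R :> rat).
  rewrite -natrM ler_nat sum_overlap card_by_columns.
  by apply: leq_trans (sqr_sum_le _) _; rewrite card_ord.
have : \sum_(x : 'I_m) #|E|%:R <= \sum_(x : 'I_m) (n%:R + \sum_r (#|line O r|%:R + (#|line O x| + 2)%:R / 2 - 3 / 2 * (overlap O x r)%:R)) :> rat.
  apply: ler_sum => x _; apply: le_trans (card_le_charge x adm) _.
  by rewrite lerD2l; apply: sum_charge.
have -> : \sum_(x : 'I_m) (n%:R + \sum_r (#|line O r|%:R + (#|line O x| + 2)%:R / 2 - 3 / 2 * (overlap O x r)%:R))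
  = m%:R * n%:R + m%:R * #|O|%:R + m%:R * (#|O|%:R / 2 + m%:R) - 3 / 2 * (\sum_x \sum_r overlap O x r)%:R :> rat.
  rewrite big_split /= sumr_const card_ord -[n%:R *+ m]mulr_natl.
  rewrite (eq_bigr (fun x => #|O|%:R + m%:R * (#|line O x|%:R / 2 + 1) - 3 / 2 * (\sum_r overlap O x r)%:R)).
    rewrite sumrB big_split /= sumr_const card_ord -mulr_sumr -mulr_sumr -natr_sum.
    rewrite big_split /= -mulr_suml -natr_sum -card_by_lines sumr_const card_ord -mulr_natl.
    by field.
  move=> x _; rewrite sumrB big_split /= -natr_sum -card_by_lines sumr_const card_ord.
  rewrite -mulr_sumr -natr_sum -[X in _ + X - _]mulr_natl natrD.
  by field.
rewrite sumr_const card_ord -[_ *+ m]mulr_natl; move: C.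
have m0 : 0 <= m%:R :> rat by apply: ler0n.
have n0 : 0 <= n%:R :> rat by apply: ler0n.
move: T2 OmN; rewrite -2!(ler_nat rat) !natrM. 
have -> : (3 * #|E| <= m * n + 3 * (m + n))%N = (3 * #|E|%:R <= m%:R * n%:R + 3 * (m%:R + n%:R) :> rat).
  by rewrite -(ler_nat rat) !(natrD, natrM).
move: (\sum_x _)%N%:R #|E|%:R #|O|%:R m%:R n%:R m0 n0 => s t o a b a0 b0 T2 oab cs sm.
have [small|big] := lerP (4 * t) (a * b); first by lra.
rewrite leNgt; apply/negP => contra.
have ab0 : 0 <= a * b by apply: mulr_ge0.
have h1 : 0 <= (o - 2 * t) * (o + 2 * t - a * b) by apply: mulr_ge0; lra.
have h2 : 0 < t * (6 * t - 2 * (a * b) - 6 * (a + b)) by apply: mulr_gt0; lra.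
have h3 : 0 <= (4 * t - a * b) * (a + b) by apply: mulr_ge0; lra.
have h4 : b * (a * t) <= b * (a * b + a * o + a * (o / 2 + a) - 3 / 2 * s) by apply: ler_wpM2l => //; lra.
have h5 : 0 <= a * b * (a + b) by rewrite !mulr_ge0 // addr_ge0.
by clear cardC; lra.
Qed.
End Third.

From mathcomp Require Import reals.

(** * Quantitative estimates *)

Section Real.
Variable R : realType.
Local Open Scope ring_scope.
Implicit Types (eta : R).

Lemma natrB_ge (a b : nat) : a%:R - b%:R <= (a - b)%:R :> R.
Proof. by rewrite lerBlDr -natrD ler_nat; lia. Qed.

(** All error terms of [augmentation_bound] are at most a multiple of
    [eta * m * n] for [D] about [eta * n] and [K] about [eta * m]. *)
Lemma augmentation_quarter m n (B : {set 'I_m * 'I_n}) eta : C4_free B ->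
  0 < eta <= 1 -> 4 / eta ^+ 3 <= n%:R -> (n <= m)%N ->
  (forall r, #|line B r|%:R <= eta * n%:R) \/ (forall c, #|column B c|%:R <= eta * m%:R) ->
  (1 - 37 * eta) * (m%:R * n%:R) <= 4 * (Tstar B)%:R.
Proof.
move=> free /andP[eta0 eta1] large nm small.
set D := Num.truncn (eta * n%:R); set K := Num.truncn (eta * m%:R).
have en0 : 0 <= eta * n%:R by rewrite mulr_ge0 ?ler0n // ltW.
have em0 : 0 <= eta * m%:R by rewrite mulr_ge0 ?ler0n // ltW.
have Dle : D%:R <= eta * n%:R by rewrite truncn_le.
have Dgt : eta * n%:R < D%:R + 1 by rewrite natr1; apply: truncnS_gt.
have Kle : K%:R <= eta * m%:R by rewrite truncn_le.
have Dn : (D <= n)%N by rewrite -(ler_nat R); apply: le_trans Dle _; rewrite ler_piMl ?ler0n.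
have small' : (forall r, #|line B r| <= D)%N \/ (forall c, #|column B c| <= K)%N.
  by case: small => small; [left => r | right => c]; rewrite truncn_ge_nat.
have bound := augmentation_bound free Dn small'.
have beta := card_long_lines D free; have cardB := card_C4_free D free.
move: bound beta cardB; set b := #|B|; set bt := #|[set r | _]|; set T := Tstar B.
rewrite -!(ler_nat R) !(natrM, natrD) => bound beta cardB.
have eta3 : 4 <= n%:R * eta ^+ 3 by rewrite -ler_pdivrMr // exprn_gt0.
have eta_e2 : eta ^+ 2 <= 1 by rewrite expr_le1 // ltW.
have eta_e3 : eta ^+ 3 <= eta ^+ 2 by rewrite exprS ler_piMl // exprn_ge0 // ltW.
have eta_e23 : eta ^+ 2 <= eta by rewrite expr2 ler_piMl // ltW.
have n0 : 0 <= n%:R :> R by apply: ler0n.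
have eta2 : 4 <= n%:R * eta ^+ 2 by apply: le_trans eta3 _; rewrite ler_wpM2l.
have eta1' : 4 <= n%:R * eta by apply: le_trans eta2 _; rewrite ler_wpM2l.
have n4 : 4 <= n%:R :> R by apply: le_trans eta1' _; rewrite ler_piMr.
have {}bound : (m%:R - (D%:R + 1 + bt%:R)) * (n%:R - 2) <=
    4 * (T%:R + b%:R + 2 * (m%:R * D%:R + n%:R * (D%:R + K%:R))) :> R.
  apply: le_trans bound; apply: le_trans (_ : (m - (D.+1 + bt))%:R * (n%:R - 2) <= _).
    apply: ler_wpM2r; first by lra.
    by apply: le_trans (natrB_ge _ _); rewrite natrD -natr1.
  by apply: ler_wpM2l; [apply: ler0n | apply: natrB_ge].
have nmR : n%:R <= m%:R :> R by rewrite ler_nat.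
clear eta_e2 eta_e3 eta_e23 small small' large en0 em0 free Dn nm.
move: (D%:R) (K%:R) (bt%:R) (b%:R) (T%:R) (m%:R) (n%:R) (ler0n R D) (ler0n R b) (ler0n R bt)
  Dle Dgt Kle bound beta cardB nmR eta3 eta2 eta1' n4 n0.
clear D K bt b T B m n => d k bta c t x y d0 c0 bt0 Dle Dgt Kle bound beta cardB nmR eta3 eta2 eta1' n4 n0.
have x0 : 0 < x by lra.
have y0 : 0 < y by lra.
have P0 : 0 < x * y by apply: mulr_gt0.
have dhalf : eta * y / 2 <= d by lra.
have dpos : 0 < d by lra.
have betax : bta <= eta * x.
  have : bta * (eta * y / 2 * (eta * y / 2)) <= y * y.
    apply: le_trans beta; apply: ler_wpM2l => //; apply: ler_pM => //; lra.
  rewrite (_ : bta * _ = (bta * eta ^+ 2 / 4) * (y * y)); last by field.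
  rewrite -[X in _ <= X]mul1r ler_pM2r ?mulr_gt0 // => le1.
  have : bta * eta ^+ 2 <= (eta * x) * eta ^+ 2.
    rewrite (_ : eta * x * _ = x * eta ^+ 3); last by ring.
    have : y * eta ^+ 3 <= x * eta ^+ 3 by rewrite ler_wpM2r // exprn_ge0 // ltW.
    lra.
  by rewrite ler_pM2r // exprn_gt0.
have cbound : c <= 2 * eta * (x * y).
  have h1 : 2 * y / eta <= eta * (x * y).
    rewrite ler_pdivrMr // (_ : eta * (x * y) * eta = (x * eta ^+ 2) * y); last by ring.
    apply: ler_wpM2r => //; have : y * eta ^+ 2 <= x * eta ^+ 2 by rewrite ler_wpM2r // exprn_ge0 // ltW.
    lra.
  have h2 : y * y <= d * (2 * y / eta).
    apply: le_trans (_ : eta * y / 2 * (2 * y / eta) <= _).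
      by rewrite (_ : eta * y / 2 * (2 * y / eta) = y * y) //; field; rewrite gt_eqF.
    by apply: ler_wpM2r => //; rewrite divr_ge0 ?mulr_ge0 // ltW.
  have h3 : d * x <= eta * (x * y).
    by rewrite (_ : eta * (x * y) = (eta * y) * x); [apply: ler_wpM2r => //; lra | ring].
  have : c * d <= (2 * eta * (x * y)) * d.
    apply: le_trans cardB _; rewrite (_ : d * d * x = d * (d * x)); last by ring.
    have : d * (d * x + 2 * y / eta) <= d * (2 * eta * (x * y)) by apply: ler_wpM2l; lra.
    rewrite mulrDr; lra.
  by rewrite ler_pM2r.
have g1 : x * d <= eta * (x * y) by rewrite (_ : eta * (x * y) = x * (eta * y)); [apply: ler_wpM2l => //; lra | ring].
have g2 : y * d <= eta * (x * y).
  apply: le_trans g1; apply: ler_wpM2r => //.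
have g3 : y * k <= eta * (x * y) by rewrite (_ : eta * (x * y) = y * (eta * x)); [apply: ler_wpM2l => //; lra | ring].
have g4 : y <= eta * (x * y).
  rewrite mulrA -[X in X <= _]mul1r; apply: ler_wpM2r => //.
  have : y * eta <= x * eta by rewrite ler_wpM2r // ltW.
  lra.
have g5 : x <= eta * (x * y).
  rewrite mulrCA -[X in X <= _]mulr1; apply: ler_wpM2l; lra.
have g6 : bta * y <= eta * (x * y) by rewrite mulrA; apply: ler_wpM2r.
have g7 : 0 <= (d + 1 + bta) * 2 by lra.
lra.
Qed.

Lemma min_sqrt_bounds m n : (0 < n <= m)%N ->
  let mu := Num.min n%:R (Num.sqrt m%:R) : R in
  [/\ 0 < mu, mu <= n%:R, mu ^+ 2 <= m%:R & n%:R <= mu ^+ 2].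
Proof.
move=> /andP[n0 nm] mu.
have n1 : 1 <= n%:R :> R by rewrite ler1n.
have nmR : n%:R <= m%:R :> R by rewrite ler_nat.
have s0 : 0 < Num.sqrt m%:R :> R by rewrite sqrtr_gt0; lra.
have s2 : Num.sqrt m%:R ^+ 2 = m%:R :> R by rewrite sqr_sqrtr; lra.
rewrite /mu minEle; case: (lerP n%:R (Num.sqrt m%:R : R)) => le.
  split=> //; first by rewrite ltr0n.
    by rewrite -[leRHS]s2 ler_pXn2r ?nnegrE // ltW.
  by rewrite expr2 ler_peMr // ler0n.
by split; rewrite ?s2 // ltW.
Qed.

Lemma power_of_two_below (M : R) : 2 <= M ->
  exists k, [/\ (0 < k)%N, (2 ^ k)%:R <= M & M < 2 * (2 ^ k)%:R].
Proof.
move=> M2; set Q := Num.truncn M; exists (trunc_log 2 Q).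
have Q2 : (1 < Q)%N by rewrite truncn_ge_nat // (le_trans _ M2).
split; first by rewrite trunc_log_gt0.
  apply: le_trans (_ : Q%:R <= M); last by rewrite truncn_le (le_trans _ M2).
  by rewrite ler_nat trunc_logP // ltnW.
apply: lt_le_trans (truncnS_gt M) _; rewrite -natrM -expnS ler_nat.
exact: trunc_log_ltn.
Qed.

(** The number of points per block that makes best use of a line of [b] cells,
    subject to the [q] parallel classes of the plane. *)
Lemma block_size q b : (2 <= q)%N -> (4 * q <= b)%N ->
  exists t, [/\ (2 <= t <= q)%N, (t * q <= b)%N & t = q \/ (b <= 2 * (t * q))%N].
Proof.
move=> q2 qb; have q0 : (0 < q)%N by lia.
have [le|lt] := leqP q (b %/ q).
  exists q; split; [by rewrite q2 leqnn| by rewrite -leq_divRL | by left].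
have b4 : (4 <= b %/ q)%N by rewrite leq_divRL.
exists (b %/ q)%N; split; [by rewrite (ltnW lt) andbT; lia | exact: leq_trunc_div | right].
have := ltn_pmod b q0; have := div.divn_eq b q; set u := (b %/ q)%N; set v := (b %% q)%N; nia.
Qed.

Lemma crossing_arith (eta x y mu q t b z c : R) : 0 < eta <= 1 -> 0 < x ->
  0 < mu -> mu <= x -> x <= mu ^+ 2 -> 4096 <= mu * eta ^+ 3 ->
  eta * mu / 8 <= q -> eta * x <= b -> 2 <= t ->
  t = q \/ b <= 2 * (t * q) ->
  c + q ^+ 2 * t <= z + q ^+ 2 + 2 * x ->
  eta ^+ 3 / 4096 * (x * mu) < z - c.
Proof.
move=> /andP[eta0 eta1] x0 mu0 mux xmu large qge bge t2 tq gain.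
have em0 : 0 <= eta * mu / 8 by rewrite divr_ge0 // mulr_ge0 // ltW.
have e30 : 0 < eta ^+ 3 by rewrite exprn_gt0.
have w0 : 0 < eta ^+ 3 * (x * mu) by rewrite !mulr_gt0.
have q0 : 0 <= q by apply: le_trans qge.
have big : eta ^+ 3 / 512 * (x * mu) <= q ^+ 2 * t.
  case: tq => [->|bt].
    rewrite -exprSr; apply: le_trans (_ : (eta * mu / 8) ^+ 3 <= _); last first.
      by rewrite ler_pXn2r // nnegrE.
    have -> : (eta * mu / 8) ^+ 3 = eta ^+ 3 / 512 * (mu ^+ 2 * mu) by field.
    by rewrite ler_pM2l ?divr_gt0 // ler_pM2r.
  have -> : q ^+ 2 * t = q * (t * q) by ring.
  apply: le_trans (_ : (eta * mu / 8) * (eta * x / 2) <= _).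
    have -> : eta * mu / 8 * (eta * x / 2) = eta ^+ 2 / 16 * (x * mu) by field.
    rewrite ler_pM2r ?mulr_gt0 //.
    have : eta ^+ 3 <= eta ^+ 2 by rewrite exprS ler_piMl // exprn_ge0 // ltW.
    have : 0 < eta ^+ 2 by rewrite exprn_gt0.
    lra.
  apply: ler_pM => //; first by rewrite divr_ge0 // mulr_ge0 // ltW.
  lra.
have two : q ^+ 2 * 2 <= q ^+ 2 * t by rewrite ler_wpM2l // exprn_ge0.
have small : 4096 * x <= eta ^+ 3 * (x * mu).
  have -> : eta ^+ 3 * (x * mu) = mu * eta ^+ 3 * x by ring.
  by rewrite ler_pM2r.
move: gain big two small w0; set W := eta ^+ 3 * (x * mu).
have -> : eta ^+ 3 / 512 * (x * mu) = W / 512 by rewrite /W; field.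
have -> : eta ^+ 3 / 4096 * (x * mu) = W / 4096 by rewrite /W; field.
move: (q ^+ 2 * t) (q ^+ 2) W => u v W; clear; lra.
Qed.

(** The gain of [crossing_gain] for the largest plane whose order [q] is at most
    [eta / 4] times [min n (sqrt m)]: the square of [q] has to fit into a column
    of [eta * m] cells and [2 q] into a line of [eta * n] cells. *)
Lemma crossing_deficit m n (B : {set 'I_m * 'I_n}) x0 y0 eta : C4_free B ->
  0 < eta <= 1 -> (n <= m)%N -> (4096 / eta ^+ 3) ^+ 2 <= n%:R ->
  eta * n%:R <= #|line B x0|%:R -> eta * m%:R <= #|column B y0|%:R ->
  eta ^+ 3 / 4096 * (n%:R * Num.min n%:R (Num.sqrt m%:R)) < (zar m n)%:R - #|B|%:R.
Proof.
move=> free eta01 nm large lx cy; have /andP[eta0 eta1] := eta01.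
have e3 : 0 < eta ^+ 3 by rewrite exprn_gt0.
have nR0 : 0 < n%:R :> R.
  apply: lt_le_trans large; rewrite exprn_gt0 // divr_gt0 //.
have n0 : (0 < n)%N by rewrite -(ltr0n R).
have [mu0 mun mum nmu] := @min_sqrt_bounds m n (introT andP (conj n0 nm)).
set mu := Num.min _ _ in mu0 mun mum nmu *; clearbody mu.
have mularge : 4096 <= mu * eta ^+ 3.
  have nn : 0 <= 4096 / eta ^+ 3 by rewrite divr_ge0 // ltW.
  rewrite -ler_pdivrMr // -(@ler_pXn2r _ 2%N) ?nnegrE ?(ltW mu0) //.
  exact: le_trans large nmu.
have em : 4096 <= mu * eta.
  apply: le_trans mularge _; apply: ler_wpM2l; first exact: ltW.
  by rewrite exprS ler_piMr ?exprn_ile1 // ltW.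
have [k [k0 qle qge]] := @power_of_two_below (eta * mu / 4) ltac:(clear -em; lra).
set q := (2 ^ k)%N in qle qge.
have q2 : (2 <= q)%N by rewrite /q -[X in (X <= _)%N]expn1 leq_exp2l.
have eta_mu_n : eta * mu <= eta * n%:R by rewrite ler_wpM2l // ltW.
have qb : (4 * q <= #|line B x0|)%N.
  rewrite -(ler_nat R) natrM; move: #|_|%:R q%:R lx qle => u v; clear -eta_mu_n; lra.
have colq : (q ^ 2 < #|column B y0|)%N.
  rewrite -(ltr_nat R); apply: lt_le_trans cy; rewrite natrX.
  apply: le_lt_trans (_ : (eta * mu / 4) ^+ 2 < _).
    by rewrite ler_pXn2r ?nnegrE ?ler0n // divr_ge0 // mulr_ge0 // ltW.
  have -> : (eta * mu / 4) ^+ 2 = eta * (eta * (mu ^+ 2 / 16)) by field.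
  rewrite ltr_pM2l //; apply: le_lt_trans (_ : 1 * (mu ^+ 2 / 16) < _).
    by apply: ler_wpM2r => //; rewrite divr_ge0 // sqr_ge0.
  have : 0 < mu ^+ 2 by rewrite exprn_gt0.
  by move: mum; clear; lra.
have [t [/andP[t2 tq] tb tbig]] := block_size q2 qb.
have gain := crossing_gain free k0 colq tq tb.
apply: (@crossing_arith eta n%:R m%:R mu q%:R t%:R #|line B x0|%:R) => //.
- by move: qge; clear; lra.
- by rewrite ler_nat.
- by case: tbig => [->|h]; [left | right; rewrite -!natrM ler_nat].
- move: gain; rewrite -(ler_nat R) !natrD natrM addr0 -mulr2n -[_ *+ 2]mulr_natl -(natrX R q 2).
  exact: id.
Qed.
End Real.

Lemma trunc_third x : x - 2 <= 3 * (x %/ 3).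
Proof. lia. Qed.

Lemma mul_thirds a b : 3 * (3 * a * b) = 3 * a * (3 * b).
Proof. lia. Qed.

Section Asymptotics.
Variable R : realType.
Local Open Scope ring_scope.

(** By [crossing_deficit] a base so close to the maximum cannot have both a long line
    and a long column, and [augmentation_quarter] applies. *)
Lemma near_maximum_bases (eps : R) : 0 < eps -> exists M delta : R, 0 < delta /\
  forall m n (B : {set 'I_m * 'I_n}), M <= n%:R -> (n <= m)%N -> C4_free B ->
  (zar m n)%:R - #|B|%:R <= delta * (n%:R * Num.min n%:R (Num.sqrt m%:R)) ->
  (4^-1 - eps) * (m%:R * n%:R) <= (Tstar B)%:R.
Proof.
move=> eps0; pose eta := Num.min 1 (eps / 10).
have eta0 : 0 < eta by rewrite lt_min ltr01 divr_gt0.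
have eta1 : eta <= 1 by rewrite ge_min lexx.
have etae : eta <= eps / 10 by rewrite ge_min lexx orbT.
clearbody eta; have eta01 : 0 < eta <= 1 by rewrite eta0.
have e3 : 0 < eta ^+ 3 by rewrite exprn_gt0.
exists ((4096 / eta ^+ 3) ^+ 2), (eta ^+ 3 / 4096); split; first by rewrite divr_gt0.
move=> m n B large nm free close.
have large3 : 4 / eta ^+ 3 <= n%:R.
  apply: le_trans large; set u := _^-1.
  have u1 : 1 <= u by rewrite invf_ge1 // exprn_ile1 // ltW.
  by rewrite expr2; nra.
have small : (forall r, #|line B r|%:R <= eta * n%:R) \/ (forall c, #|column B c|%:R <= eta * m%:R).
  have [/forallP|] := boolP [forall r, #|line B r|%:R <= eta * n%:R]; first by left.
  rewrite negb_forall => /existsP[x0]; rewrite -ltNge => /ltW lx.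
  have [/forallP|] := boolP [forall c, #|column B c|%:R <= eta * m%:R]; first by right.
  rewrite negb_forall => /existsP[y0]; rewrite -ltNge => /ltW cy.
  by have := crossing_deficit free eta01 nm large lx cy; rewrite ltNge close.
have := augmentation_quarter free eta01 large3 nm small.
have P0 : 0 <= m%:R * n%:R :> R by rewrite mulr_ge0 ?ler0n.
move: (m%:R * n%:R) (Tstar B)%:R P0 => P T P0 le.
have : 37 * eta * P <= 4 * eps * P by apply: ler_wpM2r => //; lra.
lra.
Qed.

Lemma zar_leq_real m n : (zar m n)%:R <= m%:R + n%:R ^+ 2 :> R.
Proof.
rewrite -natrX -natrD ler_nat; apply: leq_trans (zar_leq m n) _; rewrite leq_add2l.
exact: bin2_leq_sqr.
Qed.

(** The lines of [B] have bounded size [D], so each error term of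
    [augmentation_bound] is [O(m)]; the cases where these lemmas do not apply
    have bounded [n] and are absorbed into [C]. *)
Lemma wide_maximum_bases (c0 : R) : 0 < c0 -> exists C : R, forall m n (B : {set 'I_m * 'I_n}),
  (0 < n)%N -> c0 * n%:R ^+ 2 <= m%:R -> maximum_base B ->
  m%:R * n%:R / 4 - C * m%:R <= (Tstar B)%:R.
Proof.
move=> c00; pose a := c0^-1; have a0 : 0 < a by rewrite invr_gt0.
have [K Ka] : exists K : nat, 2 * (1 + a) <= K%:R.
  by exists (Num.truncn (2 * (1 + a))).+1; apply/ltW/truncnS_gt.
pose q := (2 ^ K.+1)%N.
pose D := (K.+1 * q)%N; pose M := (2 * q ^ 2 + 2)%N.
exists (D%:R + a * M%:R + (2 + (D%:R + 1) * a + 4 * (1 + a) + 8 * D%:R + 8 * (a * D%:R))) => m n B n0 wide maxB.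
have /andP[free /eqP cardB] := maxB.
have n2 : n%:R ^+ 2 <= a * m%:R by rewrite -ler_pdivrMl ?invrK // invr_gt0.
have n1 : 1 <= n%:R :> R by rewrite ler1n.
have nam : n%:R <= a * m%:R by apply: le_trans n2; rewrite expr2 ler_peMl //; lra.
have m0 : 0 <= m%:R :> R by apply: ler0n.
have T0 : 0 <= (Tstar B)%:R :> R by apply: ler0n.
have D0 : 0 <= D%:R :> R by apply: ler0n.
have M0 : 0 <= M%:R :> R by apply: ler0n.
have aD0 : 0 <= a * D%:R by rewrite mulr_ge0 // ltW.
have aM0 : 0 <= a * M%:R by rewrite mulr_ge0 // ltW.
set C' := 2 + _ + _ + _ + _.
have C'0 : 0 <= C' by rewrite /C' mulrDl mul1r [D%:R * a]mulrC; lra.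
have trivial_case (N : R) : n%:R <= N -> N <= D%:R + a * M%:R ->
    m%:R * n%:R / 4 - (D%:R + a * M%:R + C') * m%:R <= (Tstar B)%:R.
  move=> nN ND; apply: le_trans T0; rewrite subr_le0.
  have : n%:R * m%:R <= (D%:R + a * M%:R) * m%:R by rewrite ler_wpM2r // (le_trans nN).
  have : 0 <= C' * m%:R by rewrite mulr_ge0.
  have : 0 <= n%:R * m%:R :> R by rewrite mulr_ge0.
  rewrite [(_ + C') * _]mulrDl [m%:R * _]mulrC; lra.
have [nD|Dn] := leqP n D; first by apply: (trivial_case D%:R); [rewrite ler_nat | lra].
have [mM|Mm] := leqP m M.
  apply: (trivial_case (a * M%:R)); last by lra.
  by apply: le_trans nam _; rewrite ler_pM2l // ler_nat.
have cB : #|B|%:R <= (1 + a) * m%:R.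
  by rewrite cardB; apply: le_trans (zar_leq_real m n) _; lra.
have short : forall r, (#|line B r| <= D)%N.
  move=> r; apply: ltnW; apply: (maximum_base_short_lines maxB).
  - exact: ltn_expl.
  - rewrite -(ler_nat R) !natrM.
    apply: le_trans (_ : 2 * (1 + a) * m%:R <= _); first by rewrite -mulrA ler_pM2l.
    exact: ler_wpM2r.
  - exact: ltnW.
have D2 : (2 <= D)%N.
  by apply: leq_trans (leq_pmull q (ltn0Sn K)); rewrite /q -[X in (X <= _)%N]expn1 leq_exp2l.
clearbody D M.
have := augmentation_bound (K := 0) free (ltnW Dn) (or_introl short).
have -> : #|[set r | (D < #|line B r|)%N]| = 0%N.
  by apply: eq_card0 => r; rewrite inE ltnNge short.
rewrite !addn0 -(ler_nat R) !(natrM, natrD) => bound.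
have {}bound : (m%:R - (D%:R + 1)) * (n%:R - 2) <=
    4 * ((Tstar B)%:R + #|B|%:R + 2 * (m%:R * D%:R + n%:R * D%:R)) :> R.
  apply: le_trans bound; apply: le_trans (_ : (m - D.+1)%:R * (n%:R - 2) <= _).
    apply: ler_wpM2r; first by rewrite subr_ge0 ler_nat; apply: leq_trans (ltnW Dn).
    by apply: le_trans (natrB_ge _ _ _); rewrite -natr1.
  by apply: ler_wpM2l; [apply: ler0n | apply: natrB_ge].
have h1 : n%:R * D%:R <= a * m%:R * D%:R by rewrite ler_wpM2r.
have h2 : 0 <= C' * m%:R by rewrite mulr_ge0.
have h3 : 0 <= (D%:R + a * M%:R) * m%:R by rewrite mulr_ge0 // addr_ge0.
rewrite [(_ + C') * _]mulrDl.
move: bound cB nam n1 m0 D0 h1 h2 h3; rewrite {trivial_case C'0}/C'.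
move: ((D%:R + a * M%:R) * m%:R) D%:R #|B|%:R (Tstar B)%:R m%:R n%:R; clear.
move=> w d b t x y; lra.
Qed.

Lemma narrow_orders (M x y : R) : 1 <= M -> M <= y -> M * y ^+ 2 <= x ->
  [/\ 1 <= y, y <= x, M * y ^+ 3 <= x * y, M * x <= x * y & y <= y ^+ 2 /\ y ^+ 2 <= y ^+ 3].
Proof.
move=> M1 My wide; have y1 : 1 <= y by lra.
have y0 : 0 <= y by lra.
have yy : y <= y ^+ 2 by rewrite expr2 ler_peMl.
have yyy : y ^+ 2 <= y ^+ 3 by rewrite [leRHS]exprS ler_peMl // exprn_ge0.
have yx : y <= x.
  by apply: le_trans wide; apply: le_trans yy _; rewrite ler_peMl // exprn_ge0.
split=> //; first by rewrite (exprSr y 2) mulrA ler_wpM2r.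
by rewrite mulrC ler_wpM2l // (le_trans y0).
Qed.

Lemma one_column_objective (eps : R) : 0 < eps -> exists M : R,
  forall m n (B : {set 'I_m * 'I_n}), M <= n%:R -> M * n%:R ^+ 2 <= m%:R -> maximum_base B ->
  (4 * Tstar B <= n * (m + 2) + 4 * ('C(n, 2) * n + m))%N ->
  `|(#|B| + Tstar B)%:R - 4^-1 * (m%:R * n%:R)| <= eps * (m%:R * n%:R) :> R.
Proof.
move=> eps0; have [M1 [delta [delta0 near]]] := near_maximum_bases eps0.
pose M := Num.max (Num.max 1 M1) (8 / eps).
have MM1 : M1 <= M by rewrite !le_max lexx orbT.
have M1' : 1 <= M by rewrite !le_max lexx.
have Me : 8 / eps <= M by rewrite le_max lexx orbT.
clearbody M; exists M => m n B Mn wide /andP[free /eqP cardB] upper.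
have [y1 yx cube lin [sq1 sq2]] := narrow_orders M1' Mn wide.
have P0 : 0 <= m%:R * n%:R :> R by rewrite mulr_ge0 ?ler0n.
have lower : (4^-1 - eps) * (m%:R * n%:R) <= (Tstar B)%:R.
  apply: near => //; first exact: le_trans Mn.
    by rewrite -(ler_nat R).
  rewrite cardB subrr; apply: mulr_ge0; first exact: ltW.
  by rewrite mulr_ge0 ?ler0n // le_min ler0n sqrtr_ge0.
have epsM : 8 <= M * eps by rewrite -ler_pdivrMr.
have cubeP : 8 * n%:R ^+ 3 <= eps * (m%:R * n%:R).
  apply: le_trans (_ : M * eps * n%:R ^+ 3 <= _).
    by apply: ler_wpM2r => //; rewrite exprn_ge0 // ler0n.
  by rewrite -mulrA mulrCA ler_pM2l.
have linP : 8 * m%:R <= eps * (m%:R * n%:R).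
  apply: le_trans (_ : M * eps * m%:R <= _); first by apply: ler_wpM2r; rewrite ?ler0n.
  by rewrite -mulrA mulrCA ler_pM2l.
have zle := zar_leq_real m n.
have : 4 * (Tstar B)%:R <= n%:R * (m%:R + 2) + 4 * (n%:R ^+ 3 + m%:R) :> R.
  move: upper; rewrite -(ler_nat R) !(natrM, natrD) => upper; apply: le_trans upper _.
  rewrite lerD2l ler_pM2l // lerD2r (exprSr _ 2); apply: ler_wpM2r; first exact: ler0n.
  by rewrite -natrX ler_nat bin2_leq_sqr.
rewrite natrD cardB; move: zle; have := ler0n R (zar m n).
rewrite ler_distl mulrBl mulrDl in lower *.
move: sq1 sq2 cubeP linP lower y1 yx P0; rewrite (_ : n%:R * (m%:R + 2) = m%:R * n%:R + 2 * n%:R); last by ring.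
move: n%:R m%:R (zar m n)%:R (Tstar B)%:R (n%:R ^+ 2) (n%:R ^+ 3) (m%:R * n%:R).
clear -eps0 => y x z t s c P *; apply/andP; split; lra.
Qed.

Lemma zL_asymptotics (eps : R) : 0 < eps -> exists M : R,
  forall m n, M <= n%:R -> M * n%:R ^+ 2 <= m%:R ->
  `|(zL m n)%:R - 3^-1 * (m%:R * n%:R)| <= eps * (m%:R * n%:R) :> R.
Proof.
move=> eps0; pose M := Num.max 5 (8 / eps).
have M5 : 5 <= M by rewrite le_max lexx.
have Me : 8 / eps <= M by rewrite le_max lexx orbT.
clearbody M; exists M => m n Mn wide.
have [y1 yx cube lin [sq1 sq2]] := narrow_orders (le_trans (ler1n R 5) M5) Mn wide.
have epsM : 8 <= M * eps by rewrite -ler_pdivrMr.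
have cubeP : 8 * n%:R ^+ 3 <= eps * (m%:R * n%:R).
  apply: le_trans (_ : M * eps * n%:R ^+ 3 <= _).
    by apply: ler_wpM2r => //; rewrite exprn_ge0 // ler0n.
  by rewrite -mulrA mulrCA ler_pM2l.
have linP : 8 * m%:R <= eps * (m%:R * n%:R).
  apply: le_trans (_ : M * eps * m%:R <= _); first by apply: ler_wpM2r; rewrite ?ler0n.
  by rewrite -mulrA mulrCA ler_pM2l.
have zle := zar_leq_real m n.
have y5 : 5 <= n%:R :> R by lra.
have n5 : (5 <= n)%N by rewrite -(ler_nat R).
have n2m : n%:R ^+ 2 <= m%:R :> R.
  by apply: le_trans wide; rewrite ler_peMl ?exprn_ge0 ?ler0n //; lra.
have Nn2 := bin2_leq_sqr n.
have Nm : ('C(n, 2) <= m)%N.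
  by apply: leq_trans Nn2 _; rewrite -(ler_nat R) natrX.
have [|B maxB low] := @three_block_base m n _ Nm; first by apply: leq_trans n5.
have upper : (3 * zL m n <= 3 * zar m n + (m * n + 3 * (m + n)))%N.
  rewrite /zL mulnDr leq_add2l.
  rewrite mulnC -leq_divRL //; apply/bigmax_leqP => A _.
  by rewrite leq_divRL // mulnC Tstar_upper.
have lower : (Tstar B <= zL m n)%N.
  by rewrite /zL; apply: leq_trans (leq_addl _ _); apply: (leq_bigmax_cond _ maxB).
have low3 : ((m - 'C(n, 2) - 2) * (n - 5) <= 3 * zL m n)%N.
  apply: leq_trans (_ : 3 * Tstar B <= _)%N; last by rewrite leq_mul2l lower.
  apply: leq_trans (_ : 3 * (3 * ((m - 'C(n, 2)) %/ 3) * ((n - 3) %/ 3)) <= _)%N; last by rewrite leq_mul2l low.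
  rewrite mul_thirds; apply: leq_mul; first exact: trunc_third.
  by rewrite (_ : n - 5 = n - 3 - 2)%N ?trunc_third // -subnDA.
have {}low3 : (m%:R - n%:R ^+ 2 - 2) * (n%:R - 5) <= 3 * (zL m n)%:R :> R.
  apply: le_trans (_ : ((m - 'C(n, 2) - 2) * (n - 5))%:R <= _); last by rewrite -natrM ler_nat.
  rewrite natrM; apply: le_trans (_ : (m - 'C(n, 2) - 2)%:R * (n%:R - 5) <= _).
    apply: ler_wpM2r; first by lra.
    apply: le_trans (natrB_ge _ _ _); rewrite lerD2r.
    apply: le_trans (natrB_ge _ _ _); rewrite lerD2l lerN2 -natrX ler_nat //.
  by apply: ler_wpM2l; [apply: ler0n | apply: natrB_ge].
clear lower; move: (zL m n) low3 upper => z low3.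
rewrite -(ler_nat R) !(natrM, natrD) => upper.
rewrite ler_distl; move: low3; rewrite (_ : (m%:R - n%:R ^+ 2 - 2) * (n%:R - 5) =
  m%:R * n%:R - 5 * m%:R - n%:R ^+ 3 + 5 * n%:R ^+ 2 - 2 * n%:R + 10); last by ring.
move: sq1 sq2 cubeP linP upper y1 yx zle.
move: n%:R m%:R (zar m n)%:R z%:R (n%:R ^+ 2) (n%:R ^+ 3) (m%:R * n%:R).
clear -eps0 => y x w t s c P *; apply/andP; split; lra.
Qed.
End Asymptotics.

(** * Limits *)

From mathcomp Require Import all_classical all_reals all_analysis.
Import numFieldNormedType.Exports.
Local Open Scope classical_set_scope.
Local Open Scope ring_scope.

Section Limits.
Variable R : realType.

Lemma cvg_zero_natP (e : nat -> R) :
  (forall eps, 0 < eps -> \forall k \near \oo, `|e k| <= eps) -> e @ \oo --> (0 : R).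
Proof.
move=> small; apply/cvgrPdist_le => eps eps0.
by near=> k; rewrite sub0r normrN; near: k; apply: small.
Unshelve. all: by end_near. Qed.

Lemma near_leq_oo (n : nat -> nat) : n @ \oo --> \oo ->
  forall N : nat, \forall k \near \oo, (N <= n k)%N.
Proof. by move=> noo N; apply: (noo _ (nbhs_infty_ge N)). Qed.

Lemma near_ler_oo (n : nat -> nat) (M : R) : n @ \oo --> \oo ->
  \forall k \near \oo, M <= (n k)%:R.
Proof.
move=> noo; have := near_leq_oo noo (Num.truncn M).+1; apply: filterS => k Nk.
by apply: le_trans (_ : (Num.truncn M).+1%:R <= _); [exact/ltW/truncnS_gt | rewrite ler_nat].
Qed.

Lemma near_wide (m n : nat -> nat) (M : R) :
  (forall k, (2 <= m k)%N /\ (2 <= n k)%N) ->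
  ((m k)%:R / (n k)%:R ^+ 2 : R) @[k --> \oo] --> +oo ->
  \forall k \near \oo, M * (n k)%:R ^+ 2 <= (m k)%:R.
Proof.
move=> big /cvgryPge/(_ M); apply: filterS => k.
by rewrite ler_pdivlMr // exprn_gt0 // ltr0n; have [_] := big k; lia.
Qed.

Lemma relative_error_cvg (f P : nat -> R) c : (forall k, 0 < P k) ->
  (forall eps, 0 < eps -> \forall k \near \oo, `|f k - c * P k| <= eps * P k) ->
  exists e : nat -> R, e @ \oo --> (0 : R) /\ forall k, f k = (c + e k) * P k.
Proof.
move=> P0 close; exists (fun k => f k / P k - c); split; last first.
  by move=> k; rewrite addrC subrK divfK // gt_eqF.
apply: cvg_zero_natP => eps /close; apply: filterS => k.
have -> : f k / P k - c = (f k - c * P k) / P k.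
  by rewrite mulrBl mulfK // gt_eqF.
by rewrite normrM [`|(P k)^-1|]gtr0_norm ?invr_gt0 // ler_pdivrMr.
Qed.

Lemma lower_error_cvg (f P : nat -> R) c : (forall k, 0 < P k) ->
  (forall eps, 0 < eps -> \forall k \near \oo, (c - eps) * P k <= f k) ->
  exists e : nat -> R, e @ \oo --> (0 : R) /\ forall k, (c - e k) * P k <= f k.
Proof.
move=> P0 close; exists (fun k => Num.max 0 (c - f k / P k)); split; last first.
  move=> k; rewrite -ler_pdivlMr //.
  have : c - f k / P k <= Num.max 0 (c - f k / P k) by rewrite le_max lexx orbT.
  lra.
apply: cvg_zero_natP => eps eps0; have := close _ eps0; apply: filterS => k.
rewrite -ler_pdivlMr // => le; rewrite ger0_norm ?le_max ?lexx //.
by rewrite ge_max (ltW eps0) /=; lra.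
Qed.

(** The error at [k] is the supremum of the defects of all maximum bases whose
    smaller dimension is [k]. *)
Lemma maximum_bases_quarter : exists e : nat -> R, e @ \oo --> (0 : R) /\
    forall (m n : nat) (B : {set 'I_m * 'I_n}),
      (2 <= m)%N -> (2 <= n)%N -> maximum_base B ->
      (4^-1 - e (minn m n)) * (m%:R * n%:R) <= (Tstar B)%:R.
Proof.
pose defect m n (B : {set 'I_m * 'I_n}) : R := 4^-1 - (Tstar B)%:R / (m%:R * n%:R).
pose S (k : nat) : set R := [set v | v = 0 \/ exists m n (B : {set 'I_m * 'I_n}),
  [/\ (2 <= m)%N, (2 <= n)%N, maximum_base B, minn m n = k & v = defect m n B]].
have Sub k v : S k v -> v <= 4^-1.
  case=> [->|[m [n [B [_ _ _ _ ->]]]]]; first by rewrite invr_ge0.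
  by rewrite /defect gerBl divr_ge0 // mulr_ge0.
have supS k : has_sup (S k).
  by split; [exists 0; left | exists 4^-1 => v; apply: Sub].
exists (fun k => sup (S k)); split; last first.
  move=> m n B m2 n2 maxB; rewrite -ler_pdivlMr; last first.
    by rewrite mulr_gt0 // ltr0n; lia.
  have : defect m n B <= sup (S (minn m n)).
    by apply: sup_upper_bound => //; right; exists m, n, B.
  by rewrite /defect; lra.
apply: cvg_zero_natP => eps eps0.
have [M [delta [delta0 near]]] := near_maximum_bases eps0.
near=> k; rewrite ger0_norm; last by apply: sup_upper_bound => //; left.
apply: sup_le_ub; first by exists 0; left.
have tall m n (B : {set 'I_m * 'I_n}) : (n <= m)%N -> (2 <= n)%N -> maximum_base B -> n = k ->
    defect m n B <= eps.
  move=> nm n2 /andP[free /eqP maxB] nk; rewrite /defect lerBlDr addrC -lerBlDr.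
  rewrite ler_pdivlMr; last by rewrite mulr_gt0 // ltr0n; lia.
  apply: near => //.
    rewrite nk; near: k; exact: (near_ler_oo M cvg_id).
  rewrite maxB subrr; apply: mulr_ge0; first exact: ltW.
  by rewrite mulr_ge0 // le_min ler0n sqrtr_ge0.
move=> v [->|[m [n [B [m2 n2 maxB mnk ->]]]]]; first exact: ltW.
have [nm|mn] := leqP n m; first by apply: tall => //; lia.
rewrite (_ : defect m n B = defect n m (transpose B)).
  by apply: tall (maximum_base_transpose maxB) _ => //; lia.
by rewrite /defect Tstar_transpose [n%:R * _]mulrC.
Unshelve. all: by end_near. Qed.

End Limits.

Theorem theorem9 (R : realType) :
  (* (a) *)
  (exists e : nat -> R, e @ \oo --> (0 : R) /\
    forall (m n : nat) (B : {set 'I_m * 'I_n}),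
      (2 <= m)%N -> (2 <= n)%N -> maximum_base B ->
      exists E : {set {set 'I_m * 'I_n}}, admissible B E /\
        (4^-1 - e (minn m n)) * (m%:R * n%:R) <= #|E|%:R)
  /\
  (* (b) *)
  (forall c0 : R, 0 < c0 -> exists C : R,
    forall (m n : nat) (B : {set 'I_m * 'I_n}),
      (2 <= m)%N -> (2 <= n)%N -> c0 * n%:R ^+ 2 <= m%:R -> maximum_base B ->
      exists E : {set {set 'I_m * 'I_n}}, admissible B E /\
        m%:R * n%:R / 4 - C * m%:R <= #|E|%:R)
  /\
  (* (c) *)
  (forall m n : nat -> nat,
    (forall k, (2 <= m k)%N /\ (2 <= n k)%N) ->
    n @ \oo --> \oo ->
    ((m k)%:R / (n k)%:R ^+ 2 : R) @[k --> \oo] --> +oo ->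
    (exists B : forall k, {set 'I_(m k) * 'I_(n k)},
      (forall k, maximum_base (B k)) /\
      exists e : nat -> R, e @ \oo --> (0 : R) /\
        forall k, (#|B k| + Tstar (B k))%:R
                  = (4^-1 + e k) * ((m k)%:R * (n k)%:R))
    /\
    (exists e : nat -> R, e @ \oo --> (0 : R) /\
      forall k, (zL (m k) (n k))%:R
                = (3^-1 + e k) * ((m k)%:R * (n k)%:R)))
  /\
  (* (d) *)
  (forall (m n : nat -> nat) (B : forall k, {set 'I_(m k) * 'I_(n k)}),
    (forall k, (2 <= n k <= m k)%N) ->
    n @ \oo --> \oo ->
    (forall k, C4_free (B k)) ->
    (fun k => (zar (m k) (n k))%:R - #|B k|%:R : R) =o_\oo
      (fun k => (n k)%:R * Num.min (n k)%:R (Num.sqrt (m k)%:R) : R) ->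
    exists e : nat -> R, e @ \oo --> (0 : R) /\
      forall k, (4^-1 - e k) * ((m k)%:R * (n k)%:R) <= (Tstar (B k))%:R).
Proof.
split; last split; last split.
- have [e [e0 lower]] := maximum_bases_quarter R; exists e; split=> // m n B m2 n2 maxB.
  by have [E adm cardE] := Tstar_attained B; exists E; rewrite cardE; split=> //; apply: lower.
- move=> c0 /wide_maximum_bases[C bound]; exists C => m n B m2 n2 wide maxB.
  have [E adm cardE] := Tstar_attained B; exists E; rewrite cardE; split=> //.
  by apply: bound => //; lia.
- move=> m n big noo wide.
  have P0 k : 0 < (m k)%:R * (n k)%:R :> R.
    by have [? ?] := big k; rewrite mulr_gt0 // ltr0n; lia.
  split; last first.
    apply: (relative_error_cvg P0) => eps /zL_asymptotics[M close].
    near=> k; apply: close; near: k; [exact: near_ler_oo | exact: near_wide].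
  have chooseB k : exists B : {set 'I_(m k) * 'I_(n k)}, maximum_base B /\
      (('C(n k, 2) <= m k)%N ->
       (4 * Tstar B <= n k * (m k + 2) + 4 * ('C(n k, 2) * n k + m k))%N).
    have [_ n2] := big k; have [Nm|mN] := leqP 'C(n k, 2) (m k).
      by have [B maxB upper] := one_column_base n2 Nm; exists B; split.
    by have [B maxB] := maximum_base_exists (m k) (n k); exists B.
  pose B k := projT1 (cid (chooseB k)).
  have BP k := projT2 (cid (chooseB k)).
  exists B; split; first by move=> k; case: (BP k).
  apply: (relative_error_cvg P0) => eps /one_column_objective[M close].
  near=> k; have [maxB upper] := BP k; apply: close => //.
  + near: k; exact: near_ler_oo.
  + near: k; exact: near_wide.
  apply: upper; apply: leq_trans (bin2_leq_sqr _) _.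
  rewrite -(ler_nat R) natrX -[leLHS]mul1r; near: k; exact: near_wide.
- move=> m n B big noo free close.
  have P0 k : 0 < (m k)%:R * (n k)%:R :> R.
    by have /andP[n2 nm] := big k; rewrite mulr_gt0 // ltr0n; lia.
  apply: (lower_error_cvg P0) => eps /near_maximum_bases[M [delta [delta0 near]]].
  move/eqoP: close => /(_ _ delta0) close.
  near=> k; have /andP[_ nm] := big k; apply: near => //.
    near: k; exact: near_ler_oo.
  apply: le_trans (ler_norm _) _.
  have -> : (n k)%:R * Num.min (n k)%:R (Num.sqrt (m k)%:R) =
      `|(n k)%:R * Num.min (n k)%:R (Num.sqrt (m k)%:R)| :> R.
    by rewrite ger0_norm // mulr_ge0 // le_min ler0n sqrtr_ge0.
  by near: k.
Unshelve. all: by end_near. Qed.
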